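(* For $\sigma>0$ let $$g(\sigma)=\sqrt{\pi^2+(1+1/\sigma-\ln\sigma)^2}.$$ Let $\sigma_c=1.059945\ldots$ be the unique root of the equation $$\frac{g(\sigma)\sqrt{(1+1/\sigma)^2-1}}{1+1/\sigma}=\pi$$ and let $\alpha_c=\sigma_c\exp(g(\sigma_c))=41.349171\ldots$. For $\alpha>0$ and $x>1$ put $\sigma=\alpha/\ln x$, $\tau=\alpha\ln\ln x/\ln x$ and $\zeta=1/(1+\sigma)$, and consider the series $$\sum_{m=1}^\infty\ \sum_{p=0}^{m-1}\genfrac{\{}{\}}{0pt}{}{p+m-1}{p}_{\ge 2}(-1)^{p+m-1}\,\frac{\zeta^{p+m}\tau^m}{m!}.$$ Its domain of convergence depending on $\alpha$ is as follows. (i) For $0<\alpha<e$, the series is convergent when $0<\sigma<\sigma_\alpha$, where $\sigma_\alpha$ is the only root of the equation $\ln\sigma-g(\sigma)=\ln\alpha$; equivalently, when $x>x_\alpha=e^{\alpha/\sigma_\alpha}$. The series is divergent when $\sigma>\sigma_\alpha$, i.e. when $1<x<x_\alpha$. (ii) For $e<\alpha<\alpha_c$, the series is convergent for any $\sigma>0$, i.e. for any $x>1$. (iii) For $\alpha>\alpha_c$, the series is convergent when $\sigma<\mu_\alpha$ or $\sigma>\nu_\alpha$, where $\mu_\alpha<\nu_\alpha$ are the roots of the equation $|\ln\sigma-\ln\alpha|=g(\sigma)$; equivalently, when $x>e^{\alpha/\mu_\alpha}$ or $x<e^{\alpha/\nu_\alpha}$. The series is divergent when $\mu_\alpha<\sigma<\nu_\alpha$,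 i.e. when $e^{\alpha/\nu_\alpha}<x<e^{\alpha/\mu_\alpha}$.
   Context: $\genfrac{\{}{\}}{0pt}{}{n}{k}_{\ge 2}$ is the 2-associated Stirling subset number (second kind): the number of partitions of an $n$-element set into $k$ blocks each of size at least $2$ (with value $1$ for $n=k=0$). The outer sum is over $m$, with finite inner sums over $p$. *)

(* Defs.v *)
(* Stdlib reals; MathComp is used only for the finite combinatorics of set
   partitions. *)
From Stdlib Require Import Reals.
From mathcomp Require Import all_boot.

Set Implicit Arguments.
Unset Strict Implicit.
Unset Printing Implicit Defensive.

(* [partition P D] excludes empty blocks, so for n = k = 0 the only partition
   is [set0] and the value is 1. *)
Definition assoc_stirling2 (n k : nat) : nat :=
  #|[set P : {set {set 'I_n}} |
      [&& partition P [set: 'I_n], #|P| == k & [forall B in P, (2 <= #|B|)%N]]]|.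

Local Open Scope R_scope.

Definition g (s : R) : R := sqrt (PI ^ 2 + (1 + / s - ln s) ^ 2).

Definition critical_eq (s : R) : Prop :=
  g s * sqrt ((1 + / s) ^ 2 - 1) / (1 + / s) = PI.

Definition sigma_of (alpha x : R) : R := alpha / ln x.
Definition tau_of (alpha x : R) : R := alpha * ln (ln x) / ln x.
Definition zeta_of (alpha x : R) : R := / (1 + sigma_of alpha x).

(* Meaningful for 1 <= m; [sum_f_R0 f N] is the sum of f over 0 <= p <= N,
   both ends included. *)
Definition series_term (alpha x : R) (m : nat) : R :=
  sum_f_R0
    (fun p : nat =>
       INR (assoc_stirling2 (p + m - 1)%N p) * (-1) ^ (p + m - 1)%N
       * (zeta_of alpha x ^ (p + m)%N * tau_of alpha x ^ m / INR (m`!)%N))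
    (m - 1)%N.

(* Convergence of the outer sum over m >= 1, hence the shift. *)
Definition series_converges (alpha x : R) : Prop :=
  exists l : R, infinite_sum (fun k : nat => series_term alpha x k.+1) l.

(* Main.v *)
Require Import Defs.
From Stdlib Require Import Reals Lra Lia Factorial Ranalysis5.
From Coquelicot Require Import Coquelicot.
From mathcomp Require all_boot.
Local Open Scope R_scope.

(** Put [s = sigma] and [f v = s v + 1 - exp (- v)].  The outer series is
    the Taylor series at [0] of the inverse [V] of [f] with [V 0 = 0],
    evaluated at [tau = s (ln alpha - ln s)].  The critical points of [f] are
    [- ln s + (2 k + 1) i PI], with critical values
    [s (1 + / s - ln s + (2 k + 1) i PI)]; the smallest modulus of a critical
    value is [s * g s].  The radius of convergence turns out to be exactly
    that number ([radius_eq]), so the series converges when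
    [|ln alpha - ln s| < g s] and diverges when [|ln alpha - ln s| > g s].

    The coefficients.  With [e = exp (- V)] and [u = V' = / (s + e)] one has
    [(e^p u^q)' = - p e^p u^(q+1) + q e^(p+1) u^(q+2)].  Starting from [u],
    the coefficients of the successive derivatives obey, up to sign, the
    recurrence [{n+2, k+1} = (k+1) {n+1, k+1} + (n+1) {n, k}] of the
    2-associated Stirling numbers; this is [taylor_coeff_stirling].  The
    Taylor coefficients of all monomials [e^p u^q] are defined from this
    derivation rule, and the identities between them that a computation with
    functions would give are proved by induction on the order.

    The radius is at least [s * g s].  Let [R0] be the radius and suppose
    [R0 < s * g s].  On the open disc of radius [R0] the complex function [V]
    satisfies [f (V tau) = tau], as one sees by solving the differential
    equation along each ray ([branch_inverse]).  A point [v] with [f' v]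
    close to [0] is close to a critical point, hence [|f v| > R0]
    ([derivative_bounded_below]); so [u = / f' V] is bounded on the disc, by
    [U] say.  The Cauchy estimates for the powers of [u] ([cauchy_estimate])
    and the differential equation [u' = u^2 - s u^3] then bound all Taylor
    coefficients of [u] about the points of the disc uniformly, and
    re-expanding about [0] the coefficients decay like
    [(R0 + rho)^-n] with [rho > 0] ([taylor_coeff_growth]), a contradiction.

    The radius is at most [s * g s].  Otherwise [V] is defined along the
    closed segment from [0] to the critical value [tau0] in the upper half
    plane.  On the lines [Im v = PI] and [Im v = - PI] the imaginary part of
    [f] is [s PI] and [- s PI], values that the open segment does not take, so
    [V] stays in the strip between them; there the only preimage of [tau0] is the
    critical point, and [f' V * V' = 1] fails at [tau0] ([radius_le]).

    The three regimes.  [ln s - g s] increases from [-oo] to [1], which is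
    not attained; [ln s + g s] decreases to its minimum at the root [sigma_c]
    of [g s = (1 + / s) (1 + / s - ln s)], which is the critical equation, and
    then increases.  Comparing [ln alpha] with these two functions gives the
    roots and the signs of [|ln alpha - ln s| - g s]. *)

(** * Set partitions with blocks of size at least two *)
Module SetPartitions.
Import all_boot.
Local Open Scope nat_scope.
Set Implicit Arguments.
Unset Strict Implicit.
Unset Printing Implicit Defensive.

Definition assoc_partitions (T : finType) (A : {set T}) (k : nat) :=
  [set P : {set {set T}} |
    [&& partition P A, #|P| == k & [forall B in P, 2 <= #|B|]]].

Lemma assoc_partitionsP (T : finType) (A : {set T}) k P :
  reflect [/\ partition P A, #|P| = k & forall B, B \in P -> 2 <= #|B|]
          (P \in assoc_partitions A k).
Proof.
rewrite inE; apply: (iffP and3P) => -[pP cP sP]; split=> //.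
- exact/eqP.
- by move=> B BP; apply: (implyP (forallP sP B)).
- exact/eqP.
- by apply/forallP=> B; apply/implyP=> /sP.
Qed.

Lemma in_block (T : finType) (A : {set T}) (P : {set {set T}}) (x : T) :
  partition P A -> x \in A -> pblock P x \in P /\ x \in pblock P x.
Proof.
move=> /and3P[/eqP cP _ _] xA.
by rewrite pblock_mem ?mem_pblock cP.
Qed.

Lemma block_sub (T : finType) (A B : {set T}) (P : {set {set T}}) :
  partition P A -> B \in P -> B \subset A.
Proof. by move=> /and3P[/eqP <- _ _] BP; apply: (bigcup_max B). Qed.

Lemma block_unique (T : finType) (A B C : {set T}) (P : {set {set T}}) (x : T) :
  partition P A -> B \in P -> C \in P -> x \in B -> x \in C -> B = C.
Proof.
move=> /and3P[_ tP _] BP CP xB xC.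
by rewrite -(def_pblock tP BP xB) -(def_pblock tP CP xC).
Qed.

Lemma card_partitions_with_block (T : finType) (A B : {set T}) (k : nat) :
  B \subset A -> 2 <= #|B| ->
  #|[set P in assoc_partitions A k.+1 | B \in P]|
  = #|assoc_partitions (A :\: B) k|.
Proof.
move=> BA B2.
have B0 : B != set0 by rewrite -card_gt0 (leq_trans _ B2).
have nBQ (Q : {set {set T}}) : Q \in assoc_partitions (A :\: B) k -> B \notin Q.
  move=> /assoc_partitionsP[pQ _ _]; apply/negP=> /(block_sub pQ).
  by rewrite subsetD -setI_eq0 setIid (negPf B0) andbF.
rewrite -[RHS](card_in_imset (f := fun Q => B |: Q)); last first.
  by move=> Q Q' /nBQ nQ /nBQ nQ' eQ; rewrite -(setU1K nQ) eQ setU1K.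
apply: eq_card => P; rewrite inE.
apply/andP/imsetP=> [[/assoc_partitionsP[pP cP sP] BP]|[Q QA ->]].
- exists (P :\ B); last by rewrite setD1K.
  apply/assoc_partitionsP; split; first exact: partitionD1.
    by move: cP; rewrite (cardsD1 B) BP => -[].
  by move=> C /setD1P[_ /sP].
- have nQ := nBQ Q QA; have /assoc_partitionsP[pQ cQ sQ] := QA.
  split; last exact: setU11.
  apply/assoc_partitionsP; split.
  + have {1}-> : A = B :|: (A :\: B).
      apply/setP=> z; rewrite !inE; case zB: (z \in B) => //=.
      exact: (subsetP BA).
    apply: partitionU1 => //; rewrite -setI_eq0; apply/eqP/setP=> z.
    by rewrite !inE; case: (z \in B).
  + by rewrite cardsU1 nQ cQ.
  + by move=> C /setU1P[->//|/sQ].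
Qed.

(** If the block of [x] has two elements, the partition is determined by the
    other element [y] of the block and by the other blocks. *)
Lemma card_partitions_pair (T : finType) (A : {set T}) (x : T) (k : nat) :
  x \in A ->
  #|[set P in assoc_partitions A k.+1 | #|pblock P x| == 2]|
  = \sum_(y in A :\ x) #|assoc_partitions (A :\: [set x; y]) k|.
Proof.
move=> xA.
pose mate P := odflt x [pick y in pblock P x :\ x].
have mateP P : P \in assoc_partitions A k.+1 -> #|pblock P x| == 2 ->
    mate P \in A :\ x /\ pblock P x = [set x; mate P].
  move=> /assoc_partitionsP[pP _ _] c2; have [bP xb] := in_block pP xA.
  rewrite /mate; case: pickP => [y /= yb|none].
    have {}yb := setD1P yb; split.
      by rewrite !inE yb.1 (subsetP (block_sub pP bP)) // yb.2.
    apply/esym/eqP; rewrite eqEcard cards2 eq_sym yb.1 (eqP c2) andbT.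
    by apply/subsetP=> z; rewrite !inE => /orP[] /eqP-> //; case: yb.
  move: c2; rewrite (cardsD1 x) xb.
  by rewrite (eq_card0 none).
rewrite -sum1_card (partition_big mate (fun y => y \in A :\ x)); last first.
  by move=> P; rewrite inE => /andP[PA c2]; case: (mateP P PA c2).
apply: eq_bigr => y yA; rewrite sum1dep_card.
have /setD1P[yx yA'] := yA.
have sxy : [set x; y] \subset A by apply/subsetP=> z; rewrite !inE => /orP[] /eqP->.
have cxy : 2 <= #|[set x; y]| by rewrite cards2 eq_sym yx.
rewrite -(card_partitions_with_block k sxy cxy).
apply: eq_card => P; rewrite [LHS]in_set [in LHS]in_set [RHS]in_set.
apply/idP/idP.
- move=> /andP[/andP[PA c2] /eqP my].
  have [_ e] := mateP P PA c2; rewrite PA /= -my -e.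
  by have /assoc_partitionsP[pP _ _] := PA; case: (in_block pP xA).
- move=> /andP[PA bP]; have /assoc_partitionsP[pP _ _] := PA.
  have [bP' xb'] := in_block pP xA.
  have e : pblock P x = [set x; y].
    by apply: (block_unique pP bP' bP xb'); rewrite set21.
  have c2 : #|pblock P x| == 2 by rewrite e cards2 [x == y]eq_sym yx.
  rewrite PA c2 /=; have [m1 m2] := mateP P PA c2.
  have : mate P \in [set x; y] by rewrite -e m2 set22.
  by rewrite !inE; case/setD1P: m1 => /negPf->.
Qed.

(** Removing [x] from its block leaves a partition of [A :\ x] with a marked
    block, and [x] can be put back into the marked block.  So these partitions
    correspond to the pairs in [D]. *)
Lemma card_partitions_large (T : finType) (A : {set T}) (x : T) (k : nat) :
  x \in A ->
  #|[set P in assoc_partitions A k | #|pblock P x| != 2]|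
  = k * #|assoc_partitions (A :\ x) k|.
Proof.
move=> xA.
pose D := [set u : {set {set T}} * {set T} |
  (u.1 \in assoc_partitions (A :\ x) k) && (u.2 \in u.1)].
pose ins (u : {set {set T}} * {set T}) := (x |: u.2) |: (u.1 :\ u.2).
have cD : #|D| = k * #|assoc_partitions (A :\ x) k|.
  rewrite -sum1_card mulnC -sum_nat_const.
  rewrite [RHS](eq_bigr (fun Q : {set {set T}} => \sum_(B in Q) 1)); last first.
    by move=> Q /assoc_partitionsP[_ <- _]; rewrite sum1_card.
  by rewrite pair_big_dep /=; apply: eq_bigl => -[Q B]; rewrite !inE.
have xnot Q B : partition Q (A :\ x) -> B \in Q -> x \notin B.
  move=> pQ BQ; apply/negP=> xB.
  by have := subsetP (block_sub pQ BQ) x xB; rewrite !inE eqxx.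
have insP Q B : partition Q (A :\ x) -> B \in Q ->
    [/\ partition (ins (Q, B)) A, pblock (ins (Q, B)) x = x |: B
      & x |: B \notin Q :\ B].
  move=> pQ BQ; have nx := xnot Q B pQ BQ.
  have pI : partition (ins (Q, B)) A.
    rewrite /ins /=.
    have eA : A = (x |: B) :|: ((A :\ x) :\: B).
      apply/setP=> z; rewrite !inE.
      case: eqP => [->|_] //=; case zB : (z \in B) => //=.
      by have := subsetP (block_sub pQ BQ) z zB; rewrite !inE => /andP[_].
    rewrite [X in partition _ X]eA; apply: partitionU1.
    - exact: partitionD1.
    - by apply/set0Pn; exists x; rewrite setU11.
    - rewrite -setI_eq0; apply/eqP/setP=> z; rewrite !inE.
      by case: eqP => //= _; case: (z \in B).
  split=> //.
  - have /and3P[_ tI _] := pI.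
    by apply: (def_pblock tI); rewrite ?setU11.
  - apply/negP=> /setD1P[_ /(xnot _ _ pQ)]; by rewrite setU11.
rewrite -cD -(card_in_imset (f := ins)); last first.
  move=> [Q B] [Q' B']; rewrite !inE.
  move=> /= /andP[/and3P[pQ _ _] BQ] /andP[/and3P[pQ' _ _] BQ'] eI.
  have [_ b n] := insP Q B pQ BQ; have [_ b' n'] := insP Q' B' pQ' BQ'.
  have eB : B = B'.
    rewrite -(setU1K (xnot _ _ pQ BQ)) -(setU1K (xnot _ _ pQ' BQ')).
    by rewrite -b -b' eI.
  subst B'; congr (_, _).
  rewrite -(setD1K BQ) -(setD1K BQ'); congr (_ |: _).
  by rewrite -(setU1K n) -(setU1K n') /ins /= in eI *; rewrite eI.
apply: eq_card => P; rewrite inE.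
apply/andP/imsetP.
- move=> [/assoc_partitionsP[pP cP sP] n2].
  have [bP xb] := in_block pP xA; set b := pblock P x in bP xb n2 *.
  have b3 : 2 <= #|b :\ x|.
    by have := sP b bP; rewrite leq_eqVlt eq_sym (negPf n2) /= (cardsD1 x) xb.
  have nb : b :\ x \notin P :\ b.
    apply/negP=> /setD1P[nb bxP].
    have /card_gt0P[z zb] : 0 < #|b :\ x| by apply: leq_trans b3.
    have e : b :\ x = b.
      by apply: (block_unique pP bxP bP zb); case/setD1P: zb.
    by rewrite e eqxx in nb.
  exists ((b :\ x) |: (P :\ b), b :\ x); last first.
    by rewrite /ins /= setU1K // setD1K // setD1K.
  rewrite inE /= setU11 andbT; apply/assoc_partitionsP; split.
  + have -> : A :\ x = (b :\ x) :|: (A :\: b).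
      apply/setP=> z; rewrite !inE.
      case: (altP (z =P x)) => [->|_] /=; first by rewrite xb.
      case zb : (z \in b) => //=; exact: (subsetP (block_sub pP bP)).
    apply: partitionU1; first exact: partitionD1.
      by rewrite -card_gt0 (leq_trans _ b3).
    rewrite -setI_eq0; apply/eqP/setP=> z; rewrite !inE.
    by case: (z \in b); rewrite ?andbF.
  + by rewrite cardsU1 nb -cP [in RHS](cardsD1 b) bP.
  + by move=> C /setU1P[->//|/setD1P[_ /sP]].
- move=> [[Q B]]; rewrite inE /= => /andP[/assoc_partitionsP[pQ cQ sQ] BQ] ->.
  have [pI bI nI] := insP Q B pQ BQ; have nx := xnot Q B pQ BQ.
  split; last by rewrite bI cardsU1 nx; have := sQ B BQ; case: #|B| => [|[]].
  apply/assoc_partitionsP; split=> //.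
  + by rewrite /ins /= cardsU1 nI -cQ [in RHS](cardsD1 B) BQ.
  + move=> C /setU1P[->|/setD1P[_ /sQ]] //=.
    by rewrite cardsU1 nx (leq_trans (sQ B BQ)) ?leq_addl.
Qed.

Lemma card_partitions_rec (T : finType) (A : {set T}) (x : T) (k : nat) :
  x \in A ->
  #|assoc_partitions A k.+1|
  = k.+1 * #|assoc_partitions (A :\ x) k.+1|
    + \sum_(y in A :\ x) #|assoc_partitions (A :\: [set x; y]) k|.
Proof.
move=> xA; rewrite -card_partitions_large // -card_partitions_pair // addnC.
rewrite -[LHS](cardsID [set P : {set {set T}} | #|pblock P x| == 2]); congr (_ + _).
  by apply: eq_card => P; rewrite !inE.
by apply: eq_card => P; rewrite !inE andbC.
Qed.

Lemma card_partitions_0 (T : finType) (A : {set T}) :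
  #|assoc_partitions A 0| = (A == set0).
Proof.
case: eqP => [->|/eqP A0].
  rewrite (_ : assoc_partitions _ _ = [set set0]) ?cards1 //.
  apply/setP=> P; rewrite inE inE; apply/and3P/eqP.
    by move=> [_ /eqP c0 _]; apply/cards0_eq.
  move=> ->; split; rewrite ?cards0 //; last by apply/forallP=> B; rewrite inE.
  by rewrite partition_set0.
apply: eq_card0 => P; apply/negP=> /assoc_partitionsP[pP /cards0_eq P0 _].
case/set0Pn: A0 => x xA; have [] := in_block pP xA.
by rewrite P0 inE.
Qed.

Lemma card_partitions_small (T : finType) (A : {set T}) (k : nat) :
  #|A| < 2 * k -> #|assoc_partitions A k| = 0.
Proof.
move=> lt; apply: eq_card0 => P; apply/negP=> /assoc_partitionsP[pP cP sP].
move: lt; rewrite (card_partition pP) -cP mulnC -sum_nat_const ltnNge => /negP; apply.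
exact: leq_sum.
Qed.

(** The recurrence determines the numbers, so they depend on [A] through its
    cardinal only.  This replaces the transport of partitions along a
    bijection between [A] and an initial segment of the integers. *)
Lemma card_partitions_eq (T T' : finType) (A : {set T}) (A' : {set T'}) (k : nat) :
  #|A| = #|A'| -> #|assoc_partitions A k| = #|assoc_partitions A' k|.
Proof.
move: {2}#|A| (leqnn #|A|) => n; elim: n T T' k A A' => [|n IH] T T' k A A'.
  rewrite leqn0 => /eqP c0 e; case: k => [|k].
    by rewrite !card_partitions_0 -!cards_eq0 -e c0.
  by rewrite !card_partitions_small // -?e c0.
move=> cA e; case: k => [|k]; first by rewrite !card_partitions_0 -!cards_eq0 -e.
have [A0|/card_gt0P[x xA]] := posnP #|A|.
  by rewrite !card_partitions_small // -?e A0.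
have /card_gt0P[x' xA'] : 0 < #|A'| by rewrite -e; apply/card_gt0P; exists x.
have eD : #|A :\ x| = #|A' :\ x'|.
  by move: e; rewrite (cardsD1 x) (cardsD1 x' A') xA xA' => -[].
have cD : #|A :\ x| <= n by move: cA; rewrite (cardsD1 x) xA.
rewrite (card_partitions_rec _ xA) (card_partitions_rec _ xA') (IH _ _ _ _ (A' :\ x')) //.
congr (_ + _).
have eS (U U' : finType) (B : {set U}) (B' : {set U'}) (z : U) (z' : U') y y' :
    z \in B -> z' \in B' -> y \in B :\ z -> y' \in B' :\ z' -> #|B| <= n.+1 ->
    #|B| = #|B'| ->
    #|assoc_partitions (B :\: [set z; y]) k| = #|assoc_partitions (B' :\: [set z'; y']) k|.
  move=> zB zB' yB yB' cB eB.
  have c2 (V : finType) (C : {set V}) (u v : V) : u \in C -> v \in C :\ u ->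
      #|C| = (#|C :\: [set u; v]|).+2.
    move=> uC vC; rewrite (cardsD1 u) uC (cardsD1 v) vC; congr (_.+2).
    by apply: eq_card => w; rewrite !inE negb_or andbA [(w != v) && _]andbC.
  apply: IH; first by rewrite ltnW // -ltnS -(c2 _ _ _ _ zB yB).
  by apply/eqP; rewrite -2!eqSS -(c2 _ _ _ _ zB yB) -(c2 _ _ _ _ zB' yB') eB.
have [D0|/card_gt0P[y0 y0A]] := posnP #|A :\ x|.
  rewrite !big1 // => y; last by move/card0_eq: D0 => /(_ y)->.
  have D0' : #|A' :\ x'| = 0 by rewrite -eD.
  by move/card0_eq: D0' => /(_ y)->.
rewrite (eq_bigr (fun=> #|assoc_partitions (A :\: [set x; y0]) k|)); last first.
  by move=> y yA; exact: (eS _ _ _ _ _ _ _ _ xA xA yA y0A cA).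
rewrite [RHS](eq_bigr (fun=> #|assoc_partitions (A :\: [set x; y0]) k|)).
  by rewrite !sum_nat_const eD.
by move=> y yA'; apply/esym; exact: (eS _ _ _ _ _ _ _ _ xA xA' y0A yA' cA).
Qed.

Lemma assoc_stirling2_card (T : finType) (A : {set T}) (k : nat) :
  assoc_stirling2 #|A| k = #|assoc_partitions A k|.
Proof. by apply: card_partitions_eq; rewrite cardsT card_ord. Qed.

Lemma assoc_stirling2_0 (n : nat) : assoc_stirling2 n 0 = (n == 0).
Proof. by rewrite -[n]card_ord -cardsT assoc_stirling2_card card_partitions_0 cards_eq0. Qed.

Lemma assoc_stirling2_small (n k : nat) : n < 2 * k -> assoc_stirling2 n k = 0.
Proof.
move=> lt; rewrite -[n]card_ord -cardsT assoc_stirling2_card.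
by rewrite card_partitions_small // cardsT card_ord.
Qed.

Lemma assoc_stirling2_rec (n k : nat) :
  assoc_stirling2 n.+2 k.+1
  = k.+1 * assoc_stirling2 n.+1 k.+1 + n.+1 * assoc_stirling2 n k.
Proof.
have x0A : ord0 \in [set: 'I_n.+2] by rewrite inE.
have c1 : #|[set: 'I_n.+2] :\ ord0| = n.+1.
  by have := cardsD1 ord0 [set: 'I_n.+2]; rewrite x0A cardsT card_ord => -[].
rewrite -{1}[n.+2]card_ord -cardsT assoc_stirling2_card (card_partitions_rec _ x0A).
rewrite -assoc_stirling2_card c1; congr (_ + _).
rewrite -[X in _ = X * _]c1 -sum_nat_const; apply: eq_bigr => y /setD1P[y0 _].
rewrite -assoc_stirling2_card; congr assoc_stirling2.
by rewrite cardsD setTI cards2 cardsT card_ord eq_sym y0 subn2.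
Qed.

Lemma factorial_fact n : n`! = fact n.
Proof. by elim: n => // n IH; rewrite factS IH. Qed.

End SetPartitions.

Lemma assoc_stirling2_0 n : assoc_stirling2 n 0 = match n with O => 1%nat | _ => 0%nat end.
Proof. rewrite SetPartitions.assoc_stirling2_0; now destruct n. Qed.

Lemma assoc_stirling2_small n k :
  (n < 2 * k)%nat -> assoc_stirling2 n k = 0%nat.
Proof.
intros h; apply SetPartitions.assoc_stirling2_small.
now apply (ssrbool.introT (@ssrnat.leP (S n) (2 * k))).
Qed.

Lemma assoc_stirling2_rec n k :
  INR (assoc_stirling2 (S (S n)) (S k))
  = INR (S k) * INR (assoc_stirling2 (S n) (S k)) + INR (S n) * INR (assoc_stirling2 n k).
Proof. now rewrite SetPartitions.assoc_stirling2_rec, <- !mult_INR, <- plus_INR. Qed.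

(** * Taylor coefficients of the monomials in u and exp (- V) *)

(** [taylor_coeff s n p q] is the coefficient of [tau^n] in [e^p u^q], where
    [e = exp (- V)] and [u = / (s + e)].  At [tau = 0] one has [e = 1] and
    [u = / (1 + s)]; the step is the derivation rule
    [(e^p u^q)' = - p e^p u^(q+1) + q e^(p+1) u^(q+2)]. *)
Fixpoint taylor_coeff (s : R) (n p q : nat) : R :=
  match n with
  | O => (/ (1 + s)) ^ q
  | S n' =>
      (- INR p * taylor_coeff s n' p (S q)
       + INR q * taylor_coeff s n' (S p) (S (S q))) / INR (S n')
  end.

Lemma taylor_coeff_S s n p q :
  INR (S n) * taylor_coeff s (S n) p q
  = - INR p * taylor_coeff s n p (S q) + INR q * taylor_coeff s n (S p) (S (S q)).
Proof. cbn [taylor_coeff]; field; apply not_0_INR; lia. Qed.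

(** This is [e u = 1 - s u], multiplied by [e^p u^q]. *)
Lemma taylor_coeff_relation s n p q : 0 < s ->
  taylor_coeff s n (S p) (S q)
  = taylor_coeff s n p q - s * taylor_coeff s n p (S q).
Proof.
intros hs; revert p q; induction n as [|n IH]; intros p q.
  simpl; field; lra.
apply Rmult_eq_reg_l with (INR (S n)); [|apply not_0_INR; lia].
rewrite Rmult_minus_distr_l, <- Rmult_assoc, (Rmult_comm _ s), Rmult_assoc.
rewrite !taylor_coeff_S, !IH, !S_INR; ring.
Qed.

(** The Leibniz rule for the Cauchy product of two power series. *)
Lemma PS_mult_Leibniz (x y : nat -> R) (n : nat) :
  INR (S n) * PS_mult x y (S n)
  = PS_mult (fun k => INR (S k) * x (S k)) y n
    + PS_mult x (fun k => INR (S k) * y (S k)) n.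
Proof.
assert (e : INR (S n) * PS_mult x y (S n)
  = sum_f_R0 (fun k => INR k * x k * y (S n - k)%nat) (S n)
    + sum_f_R0 (fun k => x k * (INR (S n - k) * y (S n - k)%nat)) (S n)).
  unfold PS_mult; rewrite scal_sum, <- plus_sum; apply sum_eq; intros k hk.
  rewrite (minus_INR (S n) k) by lia; ring.
rewrite e; f_equal.
  rewrite decomp_sum by lia; simpl pred.
  replace (INR 0) with 0 by reflexivity; rewrite !Rmult_0_l, Rplus_0_l.
  apply sum_eq; intros k hk; replace (S n - S k)%nat with (n - k)%nat by lia; ring.
rewrite tech5; replace (S n - S n)%nat with 0%nat by lia.
replace (INR 0) with 0 by reflexivity; rewrite Rmult_0_l, Rmult_0_r, Rplus_0_r.
apply sum_eq; intros k hk; now replace (S n - k)%nat with (S (n - k)) by lia.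
Qed.

(** Both sides satisfy the same first-order recurrence in [n], by the Leibniz
    rule.  This makes the formal monomials multiply as the functions do. *)
Lemma taylor_coeff_mult s n p q p' q' :
  PS_mult (fun k => taylor_coeff s k p q) (fun k => taylor_coeff s k p' q') n
  = taylor_coeff s n (p + p') (q + q').
Proof.
revert p q p' q'; induction n as [|n IH]; intros p q p' q'.
  unfold PS_mult; simpl; rewrite pow_add; ring.
apply Rmult_eq_reg_l with (INR (S n)); [|apply not_0_INR; lia].
rewrite PS_mult_Leibniz, taylor_coeff_S.
assert (lin : forall a b (x y z : nat -> R),
  PS_mult (fun k => a * x k + b * y k) z n = a * PS_mult x z n + b * PS_mult y z n).
  intros a b x y z; unfold PS_mult; rewrite !scal_sum, <- plus_sum.
  apply sum_eq; intros; ring.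
assert (lin' : forall a b (x y z : nat -> R),
  PS_mult z (fun k => a * x k + b * y k) n = a * PS_mult z x n + b * PS_mult z y n).
  intros a b x y z; unfold PS_mult; rewrite !scal_sum, <- plus_sum.
  apply sum_eq; intros; ring.
assert (ext : forall x x' y y', (forall k, x k = x' k) -> (forall k, y k = y' k) ->
   PS_mult x y n = PS_mult x' y' n).
  intros x x' y y' hx hy; unfold PS_mult; apply sum_eq; intros; now rewrite hx, hy.
rewrite (ext _ _ _ _ (fun k => taylor_coeff_S s k p q) (fun k => eq_refl)), lin.
rewrite (ext (fun k => taylor_coeff s k p q) _ _ _ (fun k => eq_refl)
            (fun k => taylor_coeff_S s k p' q')), lin'.
rewrite !IH, !plus_INR.
replace (S q + q')%nat with (S (q + q')) by lia.
replace (q + S q')%nat with (S (q + q')) by lia.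
replace (S (S q) + q')%nat with (S (S (q + q'))) by lia.
replace (q + S (S q'))%nat with (S (S (q + q'))) by lia.
replace (S p + p')%nat with (S (p + p')) by lia.
replace (p + S p')%nat with (S (p + p')) by lia.
ring.
Qed.

Lemma taylor_coeff_00 s n : taylor_coeff s (S n) 0 0 = 0.
Proof. cbn [taylor_coeff]; change (INR 0) with 0; field; apply not_0_INR; lia. Qed.

(** The equation [(u^j)' = j (u^(j+1) - s u^(j+2))], which involves the
    powers of [u] only. *)
Lemma taylor_coeff_power_S s n j : 0 < s ->
  INR (S n) * taylor_coeff s (S n) 0 j
  = INR j * (taylor_coeff s n 0 (S j) - s * taylor_coeff s n 0 (S (S j))).
Proof.
intros hs; rewrite taylor_coeff_S, taylor_coeff_relation by exact hs.
replace (INR 0) with 0 by reflexivity; ring.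
Qed.

(** The product [j (j + 2) ... (j + 2 k - 2)]: each derivative of [u^j]
    raises the exponent by at most two. *)
Fixpoint rising2 (j k : nat) : R :=
  match k with O => 1 | S k' => INR j * rising2 (S (S j)) k' end.

Lemma rising2_ge0 j k : 0 <= rising2 j k.
Proof.
revert j; induction k as [|k IH]; intros j; simpl; [lra|].
apply Rmult_le_pos; [apply pos_INR | apply IH].
Qed.

Lemma rising2_S j k : rising2 j k <= rising2 (S j) k.
Proof.
revert j; induction k as [|k IH]; intros j; cbn [rising2]; [lra|].
apply Rmult_le_compat; [apply pos_INR|apply rising2_ge0|apply le_INR; lia|apply IH].
Qed.

Lemma rising2_fact i k :
  INR (fact i) * rising2 (S (2 * i)) k <= 2 ^ k * INR (fact (i + k)).
Proof.
revert i; induction k as [|k IH]; intros i; cbn [rising2].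
  rewrite Nat.add_0_r; simpl; lra.
specialize (IH (S i)).
replace (S (2 * S i)) with (S (S (S (2 * i)))) in IH by lia.
replace (S i + k)%nat with (i + S k)%nat in IH by lia.
apply Rle_trans with (2 * (INR (fact (S i)) * rising2 (S (S (S (2 * i)))) k)).
  rewrite fact_simpl, mult_INR.
  apply Rle_trans with ((2 * INR (S i)) * (INR (fact i) * rising2 (S (S (S (2 * i)))) k)); [|lra].
  rewrite <- Rmult_assoc, (Rmult_comm (INR (fact i))), Rmult_assoc.
  apply Rmult_le_compat_r.
    apply Rmult_le_pos; [apply pos_INR|apply rising2_ge0].
  replace 2 with (INR 2) by reflexivity; rewrite <- mult_INR; apply le_INR; lia.
simpl (2 ^ S k); rewrite Rmult_assoc; lra.
Qed.

(** If [|u^j|] is at most [U^j] on the disc of radius [R0], in the form of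
    Cauchy estimates, then the [k]-th derivative of [u] is at most
    [k! (2 K)^k U] there, where [K = U + s U^2], so [u] continues to a strictly larger disc.  The
    argument is carried out on the coefficients.  It also covers [R0 = 0],
    where it shows that the radius of convergence is positive. *)
Section Growth.
Variables (s R0 U : R).
Hypotheses (hs : 0 < s) (hR : 0 <= R0) (hU : 0 < U).
Hypothesis bound : forall j n, Rabs (taylor_coeff s n 0 j) * R0 ^ n <= U ^ j.

Let K := U + s * U ^ 2.

Lemma taylor_coeff_shift_bound k j n :
  INR (fact (n + k)) * Rabs (taylor_coeff s (n + k) 0 j) * R0 ^ n
  <= INR (fact n) * (rising2 j k * U ^ j * K ^ k).
Proof.
assert (hK : 0 <= K) by (unfold K; assert (0 <= s * U ^ 2) by (apply Rmult_le_pos; [lra|apply pow2_ge_0]); lra).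
revert j; induction k as [|k IH]; intros j.
  rewrite Nat.add_0_r; simpl.
  rewrite Rmult_1_l, Rmult_1_r, Rmult_assoc.
  apply Rmult_le_compat_l; [apply pos_INR | apply bound].
rewrite Nat.add_succ_r, fact_simpl, mult_INR.
set (m := (n + k)%nat) in *.
replace (INR (S m) * INR (fact m) * Rabs (taylor_coeff s (S m) 0 j) * R0 ^ n)
  with (INR (fact m) * Rabs (INR (S m) * taylor_coeff s (S m) 0 j) * R0 ^ n); last first.
  rewrite Rabs_mult, (Rabs_pos_eq (INR (S m))) by apply pos_INR; ring.
rewrite taylor_coeff_power_S by exact hs.
assert (hF := pos_INR (fact m)); assert (hP := pow_le R0 n hR).
assert (hf := pos_INR (fact n)).
assert (tri : Rabs (INR j * (taylor_coeff s m 0 (S j) - s * taylor_coeff s m 0 (S (S j))))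
  <= INR j * (Rabs (taylor_coeff s m 0 (S j)) + s * Rabs (taylor_coeff s m 0 (S (S j))))).
  rewrite Rabs_mult, (Rabs_pos_eq (INR j)) by apply pos_INR.
  apply Rmult_le_compat_l; [apply pos_INR|].
  eapply Rle_trans; [apply Rabs_triang|].
  rewrite Rabs_Ropp, Rabs_mult, (Rabs_pos_eq s) by lra; lra.
apply Rle_trans with (INR j * (INR (fact m) * Rabs (taylor_coeff s m 0 (S j)) * R0 ^ n
   + s * (INR (fact m) * Rabs (taylor_coeff s m 0 (S (S j))) * R0 ^ n))).
  apply Rle_trans with (INR (fact m) * (INR j * (Rabs (taylor_coeff s m 0 (S j)) + s * Rabs (taylor_coeff s m 0 (S (S j))))) * R0 ^ n); [|lra].
  apply Rmult_le_compat_r; [exact hP|]. apply Rmult_le_compat_l; assumption.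
assert (b1 := IH (S j)); assert (b2 := IH (S (S j))).
assert (mono : INR (fact n) * (rising2 (S j) k * U ^ S j * K ^ k)
   <= INR (fact n) * (rising2 (S (S j)) k * U ^ S j * K ^ k)).
  apply Rmult_le_compat_l; [exact hf|].
  apply Rmult_le_compat_r; [apply pow_le, hK|].
  apply Rmult_le_compat_r; [apply pow_le; lra|apply rising2_S].
apply Rle_trans with (INR j * (INR (fact n) * (rising2 (S (S j)) k * U ^ S j * K ^ k)
   + s * (INR (fact n) * (rising2 (S (S j)) k * U ^ S (S j) * K ^ k)))).
  apply Rmult_le_compat_l; [apply pos_INR|].
  apply Rplus_le_compat; [lra|apply Rmult_le_compat_l; lra].
right; cbn [rising2]; unfold K; simpl pow; ring.
Qed.

(** Expanding [(R0 + rho)^m] by the binomial formula gives one term for each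
    order [k] of derivation; with [rho = / (4 K)] the [k]-th term is at most
    [U / 2^k]. *)
Lemma taylor_coeff_growth m :
  Rabs (taylor_coeff s m 0 1) * (R0 + / (4 * K)) ^ m <= 2 * U.
Proof.
assert (hK : 0 < K) by (unfold K; assert (0 <= s * U ^ 2) by (apply Rmult_le_pos; [lra|apply pow2_ge_0]); lra).
rewrite Rplus_comm, binomial, scal_sum.
apply Rle_trans with (sum_f_R0 (fun k => U * (/ 2) ^ k) m); last first.
  rewrite <- (sum_eq (fun k => (/ 2) ^ k * U)) by (intros; ring).
  rewrite <- scal_sum, tech3 by lra.
  assert (0 < (/ 2) ^ S m) by (apply pow_lt; lra).
  replace (1 - / 2) with (/ 2) by lra.
  rewrite (Rmult_comm 2 U).
  apply Rmult_le_compat_l; lra.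
apply sum_Rle; intros k hk.
assert (h := taylor_coeff_shift_bound k 1 (m - k)).
replace (m - k + k)%nat with m in h by lia.
assert (hfa := rising2_fact 0 k); simpl in hfa; rewrite Rmult_1_l in hfa.
assert (f1 := INR_fact_lt_0 (m - k)); assert (f2 := INR_fact_lt_0 k).
assert (hKk := pow_lt K k hK).
unfold Binomial.C.
assert (e : (/ (4 * K)) ^ k = (/ 2) ^ k * / (2 ^ k) * / (K ^ k)).
  replace (/ (4 * K)) with (/ 2 * / 2 * / K) by (field; lra).
  rewrite !Rpow_mult_distr, <- Rinv_pow, <- Rinv_pow by lra; reflexivity.
rewrite e.
assert (h2k := pow_lt 2 k ltac:(lra)); assert (hhk := pow_lt (/ 2) k ltac:(lra)).
apply Rle_trans with ((/ 2) ^ k * (/ (INR (fact k) * 2 ^ k * K ^ k) * / INR (fact (m - k)) *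
   (INR (fact m) * Rabs (taylor_coeff s m 0 1) * R0 ^ (m - k)))).
  right; field; repeat split; lra.
rewrite (Rmult_comm U); apply Rmult_le_compat_l; [lra|].
apply Rle_trans with (/ (INR (fact k) * 2 ^ k * K ^ k) * / INR (fact (m - k)) *
  (INR (fact (m - k)) * (2 ^ k * INR (fact k) * U * K ^ k))).
  apply Rmult_le_compat_l.
    apply Rmult_le_pos; left; apply Rinv_0_lt_compat; [|exact f1].
    repeat apply Rmult_lt_0_compat; lra.
  eapply Rle_trans; [exact h|].
  apply Rmult_le_compat_l; [lra|]. rewrite pow_1.
  apply Rmult_le_compat_r; [lra|]. apply Rmult_le_compat_r; lra.
right; field; repeat split; lra.
Qed.
End Growth.

(** * The double sum as a Taylor coefficient *)

(** The [k]-th derivative of [u] is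
    [sum_p (-1)^(p+k) {p+k, p} e^p u^(p+k+1)]; the statement is its
    coefficient of [tau^n].  The induction on [k] applies the derivation rule
    once and regroups the result by the Stirling recurrence. *)
Lemma taylor_coeff_stirling s k n :
  INR (fact (n + k)) * taylor_coeff s (n + k) 0 1
  = INR (fact n) *
    sum_f_R0 (fun p => (-1) ^ (p + k) * INR (assoc_stirling2 (p + k) p)
                       * taylor_coeff s n p (p + k + 1)) k.
Proof.
revert n; induction k as [|k IH]; intros n.
  simpl sum_f_R0; rewrite Nat.add_0_r, assoc_stirling2_0; simpl; ring.
replace (n + S k)%nat with (S n + k)%nat by lia; rewrite IH.
rewrite fact_simpl, mult_INR, (Rmult_comm (INR (S n))), Rmult_assoc; f_equal.
pose (A p := - ((-1) ^ (p + k) * INR (assoc_stirling2 (p + k) p) * INR p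
             * taylor_coeff s n p (p + k + 2))).
pose (B p := (-1) ^ (p + k) * INR (assoc_stirling2 (p + k) p) * INR (p + k + 1)
             * taylor_coeff s n (S p) (p + k + 3)).
transitivity (sum_f_R0 A k + sum_f_R0 B k).
  rewrite scal_sum, <- plus_sum; apply sum_eq; intros p _.
  rewrite Rmult_assoc, (Rmult_comm (taylor_coeff _ _ _ _)), taylor_coeff_S; unfold A, B.
  replace (S (p + k + 1)) with (p + k + 2)%nat by lia.
  replace (S (p + k + 2)) with (p + k + 3)%nat by lia.
  ring.
(* the diagonal term [p = k + 1] of the first sum vanishes: {2k+1, k+1} = 0 *)
assert (A0 : A (S k) = 0).
  unfold A; rewrite assoc_stirling2_small by lia; change (INR 0) with 0; ring.
assert (A00 : A 0%nat = 0) by (unfold A; change (INR 0) with 0; ring).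
assert (shift : sum_f_R0 A k = sum_f_R0 (fun p => A (S p)) k).
  assert (h := tech5 A k); rewrite A0, Rplus_0_r in h; rewrite <- h.
  rewrite decomp_sum, A00, Rplus_0_l by lia; reflexivity.
rewrite shift, <- plus_sum, (decomp_sum _ (S k)) by lia.
rewrite Nat.add_0_l, assoc_stirling2_0; change (INR 0) with 0.
rewrite Rmult_0_r, Rmult_0_l, Rplus_0_l; simpl pred.
apply sum_eq; intros p _.
replace (S p + S k)%nat with (S (S (p + k))) by lia.
rewrite assoc_stirling2_rec; unfold A, B.
replace (S p + k)%nat with (S (p + k)) by lia.
replace (S (S (p + k)) + 1)%nat with (p + k + 3)%nat by lia.
replace (S (p + k) + 2)%nat with (p + k + 3)%nat by lia.
replace (p + k + 1)%nat with (S (p + k)) by lia.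
rewrite <- !tech_pow_Rmult; ring.
Qed.

Lemma series_term_taylor alpha x k :
  series_term alpha x (S k)
  = taylor_coeff (sigma_of alpha x) k 0 1 / INR (S k) * tau_of alpha x ^ S k.
Proof.
assert (h := taylor_coeff_stirling (sigma_of alpha x) k 0).
rewrite Nat.add_0_l in h.
assert (fk := INR_fact_lt_0 k).
assert (Sk : INR (S k) <> 0) by (apply not_0_INR; lia).
assert (e : taylor_coeff (sigma_of alpha x) k 0 1 =
  / INR (fact k) * sum_f_R0 (fun p => (-1) ^ (p + k) * INR (assoc_stirling2 (p + k) p)
                       * zeta_of alpha x ^ (p + k + 1)) k).
  apply (Rmult_eq_reg_l (INR (fact k))); [|lra].
  rewrite h; cbn [taylor_coeff fact INR]; fold (zeta_of alpha x); field; lra.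
rewrite e; unfold series_term.
replace (ssrnat.subn (S k) 1) with k by (unfold ssrnat.subn; cbn; lia).
unfold Rdiv; rewrite (Rmult_comm (/ INR (fact k))), !Rmult_assoc, (Rmult_comm (sum_f_R0 _ _)), scal_sum.
apply sum_eq; intros p _.
replace (ssrnat.subn (ssrnat.addn p (S k)) 1) with (p + k)%nat
  by (unfold ssrnat.subn, ssrnat.addn; cbn; lia).
replace (ssrnat.addn p (S k)) with (p + k + 1)%nat
  by (unfold ssrnat.addn; cbn; lia).
rewrite SetPartitions.factorial_fact, fact_simpl, mult_INR.
field; split; [exact Sk | lra].
Qed.

(** * Power series on circles and the Cauchy estimate *)
Lemma CV_radius_dominated (x y : nat -> R) :
  (forall n, Rabs (x n) <= Rabs (y n)) -> Rbar_le (CV_radius y) (CV_radius x).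
Proof.
intros h; eapply is_lub_Rbar_subset; [|apply CV_radius_bounded|apply CV_radius_bounded].
intros r [M hM]; exists M; intros n; eapply Rle_trans; [|apply (hM n)].
rewrite !Rabs_mult; apply Rmult_le_compat_r; [apply Rabs_pos|apply h].
Qed.

Definition cos_coeff (x : nat -> R) (th : R) (n : nat) := x n * cos (INR n * th).
Definition sin_coeff (x : nat -> R) (th : R) (n : nat) := x n * sin (INR n * th).

(** The sum of the real power series [x] at the complex point
    [r exp (i th)], written with two real power series in [r]. *)
Definition on_circle (x : nat -> R) (th r : R) : C :=
  (PSeries (cos_coeff x th) r, PSeries (sin_coeff x th) r).

Lemma Rabs_mult_le1 a b : Rabs b <= 1 -> Rabs (a * b) <= Rabs a.
Proof.
intros h; rewrite Rabs_mult; rewrite <- (Rmult_1_r (Rabs a)) at 2.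
apply Rmult_le_compat_l; [apply Rabs_pos|]; lra.
Qed.

Lemma Rabs_cos_le1 t : Rabs (cos t) <= 1.
Proof. apply Rabs_le; apply COS_bound. Qed.

Lemma Rabs_sin_le1 t : Rabs (sin t) <= 1.
Proof. apply Rabs_le; apply SIN_bound. Qed.

Lemma inside_dominated (x y : nat -> R) r :
  (forall n, Rabs (x n) <= Rabs (y n)) ->
  Rbar_lt (Rabs r) (CV_radius y) -> Rbar_lt (Rabs r) (CV_radius x).
Proof. intros h hr; eapply Rbar_lt_le_trans; [exact hr | now apply CV_radius_dominated]. Qed.

Lemma inside_cos x th r :
  Rbar_lt (Rabs r) (CV_radius x) -> Rbar_lt (Rabs r) (CV_radius (cos_coeff x th)).
Proof. apply inside_dominated; intros n; apply Rabs_mult_le1, Rabs_cos_le1. Qed.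

Lemma inside_sin x th r :
  Rbar_lt (Rabs r) (CV_radius x) -> Rbar_lt (Rabs r) (CV_radius (sin_coeff x th)).
Proof. apply inside_dominated; intros n; apply Rabs_mult_le1, Rabs_sin_le1. Qed.

Lemma on_circle_mult x y th r :
  Rbar_lt (Rabs r) (CV_radius x) -> Rbar_lt (Rabs r) (CV_radius y) ->
  on_circle (PS_mult x y) th r = Cmult (on_circle x th r) (on_circle y th r).
Proof.
intros hx hy; unfold on_circle, Cmult; cbn [fst snd].
assert (cx := inside_cos x th r hx); assert (sx := inside_sin x th r hx).
assert (cy := inside_cos y th r hy); assert (sy := inside_sin y th r hy).
rewrite <- !PSeries_mult by assumption.
rewrite <- PSeries_minus, <- PSeries_plus by (apply ex_pseries_mult; assumption).
f_equal; apply PSeries_ext; intros n.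
- unfold PS_minus, PS_plus, PS_opp, cos_coeff, sin_coeff, PS_mult.
  unfold plus, opp; simpl.
  match goal with |- _ = ?a + - ?b => change (a + - b) with (a - b) end.
  rewrite <- minus_sum, Rmult_comm, scal_sum.
  apply sum_eq; intros k hk.
  replace (INR n * th) with (INR k * th + INR (n - k) * th)
    by (rewrite minus_INR by lia; ring).
  rewrite cos_plus; ring.
- unfold PS_plus, cos_coeff, sin_coeff, PS_mult.
  unfold plus; simpl; rewrite <- plus_sum, Rmult_comm, scal_sum.
  apply sum_eq; intros k hk.
  replace (INR n * th) with (INR k * th + INR (n - k) * th)
    by (rewrite minus_INR by lia; ring).
  rewrite sin_plus; ring.
Qed.

Lemma Dirichlet_kernel t M :
  2 * sin (t / 2) * sum_f_R0 (fun j => cos (INR j * t)) M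
  = sin ((INR M + / 2) * t) + sin (t / 2).
Proof.
induction M as [|M IH].
  simpl; rewrite Rmult_0_l, cos_0; replace ((0 + / 2) * t) with (t / 2) by field; ring.
rewrite tech5, Rmult_plus_distr_l, IH, S_INR.
replace ((INR M + / 2) * t) with ((INR M + 1) * t - t / 2) by field.
replace ((INR M + 1 + / 2) * t) with ((INR M + 1) * t + t / 2) by field.
rewrite sin_minus, sin_plus; ring.
Qed.

Lemma roots_of_unity_orthogonal n m M : (n <= M)%nat -> (m <= M)%nat -> n <> m ->
  sum_f_R0 (fun j => cos (INR j * ((INR m - INR n) * (2 * PI / INR (S M))))) M = 0.
Proof.
intros hn hm hnm.
assert (hN : 0 < INR (S M)) by (apply lt_0_INR; lia).
set (t := (INR m - INR n) * (2 * PI / INR (S M))).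
assert (hpi := PI_RGT_0).
assert (ht : sin (t / 2) <> 0).
  assert (e : t / 2 = (INR m - INR n) / INR (S M) * PI) by (unfold t; field; lra).
  assert (b : forall a c, (a < c)%nat -> (c <= M)%nat -> 0 < sin ((INR c - INR a) / INR (S M) * PI)).
    intros a c hac hc; apply lt_INR in hac.
    assert (hc' : INR c < INR (S M)) by (apply lt_INR; lia).
    assert (ha := pos_INR a).
    assert (0 < (INR c - INR a) / INR (S M)) by (apply Rdiv_lt_0_compat; lra).
    assert ((INR c - INR a) / INR (S M) < 1).
      apply Rmult_lt_reg_r with (INR (S M)); [lra|]; unfold Rdiv.
      rewrite Rmult_assoc, Rinv_l by lra; lra.
    apply sin_gt_0; [apply Rmult_lt_0_compat; lra|].
    rewrite <- (Rmult_1_l PI) at 2; apply Rmult_lt_compat_r; lra.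
  destruct (Nat.lt_total n m) as [h|[h|h]]; [|congruence|].
    rewrite e; assert (h' := b _ _ h hm); lra.
  rewrite e; assert (h' := b _ _ h hn).
  replace ((INR m - INR n) / INR (S M) * PI) with (- ((INR n - INR m) / INR (S M) * PI)) by (field; lra).
  rewrite sin_neg; lra.
apply Rmult_eq_reg_l with (2 * sin (t / 2)); [|lra].
rewrite Dirichlet_kernel, Rmult_0_r.
assert (e : sin ((INR M + / 2) * t) = sin (- (t / 2))).
  rewrite <- (sin_period (- (t / 2)) m), <- (sin_period ((INR M + / 2) * t) n).
  f_equal; unfold t; rewrite S_INR in hN |- *; field; lra.
rewrite e, sin_neg; ring.
Qed.

Lemma Series_tail (a : nat -> R) M :
  ex_series (fun n => Rabs (a n)) ->
  Rabs (Series a - sum_f_R0 a M)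
  <= Series (fun n => Rabs (a n)) - sum_f_R0 (fun n => Rabs (a n)) M.
Proof.
intros h; rewrite (Series_incr_n a (S M)), (Series_incr_n (fun n => Rabs (a n)) (S M)); try lia; simpl pred.
- replace (sum_f_R0 a M + Series (fun k => a (S M + k)%nat) - sum_f_R0 a M)
    with (Series (fun k => a (S M + k)%nat)) by ring.
  replace (_ - _) with (Series (fun k => Rabs (a (S M + k)%nat))) by ring.
  apply Series_Rabs; now apply (ex_series_incr_n (fun n => Rabs (a n)) (S M)).
- exact h.
- now apply ex_series_Rabs.
Qed.

Lemma sum_exchange (a : nat -> R) (c : nat -> nat -> R) K M :
  sum_f_R0 (fun j => sum_f_R0 (fun m => a m * c m j) K) M
  = sum_f_R0 (fun m => a m * sum_f_R0 (fun j => c m j) M) K.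
Proof.
induction K as [|K IH]; simpl.
  rewrite scal_sum; apply sum_eq; intros; ring.
rewrite plus_sum, IH, (scal_sum (fun j => c (S K) j)); f_equal.
apply sum_eq; intros; ring.
Qed.

Lemma sum_single (f : nat -> R) n M :
  (n <= M)%nat -> (forall m, (m <= M)%nat -> m <> n -> f m = 0) -> sum_f_R0 f M = f n.
Proof.
intros hn hf; induction M as [|M IH].
  now replace n with 0%nat by lia.
rewrite tech5; destruct (Nat.eq_dec n (S M)) as [->|hne].
  rewrite (sum_eq _ (fun _ => 0)), sum_cte by (intros; apply hf; lia); ring.
rewrite IH, (hf (S M)) by (try lia; intros; apply hf; lia); ring.
Qed.

(** Averaging the [M]-th partial sum times [exp (- i n th)] over the
    [M + 1]-st roots of unity isolates its [n]-th term.  The average is at most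
    [B] plus the tail of the absolutely convergent series at [r], and the
    tail tends to [0]. *)
Lemma cauchy_estimate (x : nat -> R) (r B : R) (n : nat) :
  0 <= r -> Rbar_lt r (CV_radius x) ->
  (forall th, Cmod (on_circle x th r) <= B) ->
  Rabs (x n) * r ^ n <= B.
Proof.
intros hr0 hr hB.
assert (hr' : Rbar_lt (Rabs r) (CV_radius x)) by (rewrite Rabs_pos_eq; assumption).
assert (absx := CV_disk_inside x r hr').
set (T := Series (fun k => Rabs (x k * r ^ k))).
set (P := fun M => sum_f_R0 (fun k => Rabs (x k * r ^ k)) M).
(* the component of the sum in the direction of [exp (i n th)] *)
assert (proj : forall th M,
  Rabs (sum_f_R0 (fun m => x m * r ^ m * cos ((INR m - INR n) * th)) M) <= B + (T - P M)).
  intros th M.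
  set (a := fun m => x m * r ^ m * cos ((INR m - INR n) * th)).
  assert (ha : forall m, Rabs (a m) <= Rabs (x m * r ^ m))
    by (intros m; apply Rabs_mult_le1, Rabs_cos_le1).
  assert (exa : ex_series (fun m => Rabs (a m))).
    apply (ex_series_le (fun m => Rabs (a m)) (fun m => Rabs (x m * r ^ m))); [|exact absx].
    intros m; change (norm (Rabs (a m))) with (Rabs (Rabs (a m))); rewrite Rabs_Rabsolu; apply ha.
  assert (tail : Rabs (Series a - sum_f_R0 a M) <= T - P M).
    eapply Rle_trans; [now apply Series_tail|].
    unfold T, P.
    rewrite (Series_incr_n (fun k => Rabs (a k)) (S M)), (Series_incr_n (fun k => Rabs (x k * r ^ k)) (S M)) by (try lia; assumption).
    simpl pred.
    assert (Series (fun k => Rabs (a (S M + k)%nat)) <= Series (fun k => Rabs (x (S M + k)%nat * r ^ (S M + k)))).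
      apply Series_le; [intros k; split; [apply Rabs_pos|apply ha]|].
      now apply (ex_series_incr_n (fun n => Rabs (x n * r ^ n)) (S M)).
    lra.
  assert (full : Rabs (Series a) <= B).
    assert (e : Series a = cos (INR n * th) * fst (on_circle x th r) + sin (INR n * th) * snd (on_circle x th r)).
      unfold on_circle; simpl; rewrite <- !PSeries_scal, <- PSeries_plus.
      - unfold PSeries; apply Series_ext; intros m.
        unfold a, PS_plus, PS_scal, cos_coeff, sin_coeff, plus, scal; simpl; unfold mult; simpl.
        replace ((INR m - INR n) * th) with (INR m * th - INR n * th) by ring.
        rewrite cos_minus; ring.
      - apply ex_pseries_scal; [apply Rmult_comm|apply CV_radius_inside, inside_cos, hr'].
      - apply ex_pseries_scal; [apply Rmult_comm|apply CV_radius_inside, inside_sin, hr'].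
    apply Rle_trans with (2 := hB th); rewrite e.
    destruct (on_circle x th r) as [p q]; unfold Cmod; simpl.
    assert (cs := sin2_cos2 (INR n * th)); unfold Rsqr in cs.
    rewrite <- sqrt_Rsqr_abs; apply sqrt_le_1_alt; unfold Rsqr.
    assert (0 <= (cos (INR n * th) * q - sin (INR n * th) * p) ^ 2) by apply pow2_ge_0.
    nra.
  replace (sum_f_R0 a M) with (Series a - (Series a - sum_f_R0 a M)) by ring.
  eapply Rle_trans; [apply Rabs_triang|]; rewrite Rabs_Ropp; lra.
assert (avg : forall M, (n <= M)%nat -> Rabs (x n * r ^ n) <= B + (T - P M)).
  intros M hM.
  assert (hN : 0 < INR (S M)) by (apply lt_0_INR; lia).
  pose (t := 2 * PI / INR (S M)).
  assert (e : INR (S M) * (x n * r ^ n) = sum_f_R0 (fun j =>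
     sum_f_R0 (fun m => x m * r ^ m * cos ((INR m - INR n) * (INR j * t))) M) M).
    rewrite sum_exchange, (sum_single _ n).
    - replace (sum_f_R0 _ M) with (sum_f_R0 (fun _ => 1) M); [rewrite sum_cte; ring|].
      apply sum_eq; intros j _; rewrite Rminus_eq_0, Rmult_0_l, cos_0; reflexivity.
    - exact hM.
    - intros m hm hmn.
      assert (z : sum_f_R0 (fun j => cos ((INR m - INR n) * (INR j * t))) M = 0).
        rewrite <- (roots_of_unity_orthogonal n m M hM hm (not_eq_sym hmn)).
        apply sum_eq; intros j _; f_equal; unfold t; ring.
      rewrite z; ring.
  apply Rmult_le_reg_l with (INR (S M)); [exact hN|].
  rewrite <- (Rabs_pos_eq (INR (S M))) at 1 by lra.
  rewrite <- Rabs_mult, e; eapply Rle_trans; [apply sum_f_R0_triangle|].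
  rewrite Rmult_comm, <- sum_cte; apply sum_Rle; intros j _; apply proj.
rewrite Rabs_mult, (Rabs_pos_eq (r ^ n)) in avg by now apply pow_le.
assert (lim : is_lim_seq (fun M => B + (T - P (M + n)%nat)) (B + (T - T))).
  apply (is_lim_seq_plus' _ _ B (T - T)); [apply is_lim_seq_const|].
  apply (is_lim_seq_minus' _ _ T T); [apply is_lim_seq_const|].
  apply (is_lim_seq_incr_n P n).
  apply is_lim_seq_ext with (2 := Series_correct _ absx).
  intros M; apply sum_n_Reals.
replace B with (B + (T - T)) by ring.
assert (c := is_lim_seq_const (Rabs (x n) * r ^ n)).
refine (is_lim_seq_le _ _ _ _ _ c lim).
intros M; apply avg; lia.
Qed.

(** * The inverse branch along a ray *)
Lemma CV_radius_le_of_convergent (x y : nat -> R) :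
  (forall r, Rbar_lt (Rabs r) (CV_radius y) -> ex_pseries x r) ->
  Rbar_le (CV_radius y) (CV_radius x).
Proof.
intros h; apply Rbar_not_lt_le; intros hlt.
assert (hx := CV_radius_ge_0 x).
assert (exists r, 0 <= r /\ Rbar_lt (CV_radius x) r /\ Rbar_lt r (CV_radius y)) as [r [r0 [hr1 hr2]]].
  destruct (CV_radius x) as [rx| |]; simpl in *; try easy.
  destruct (CV_radius y) as [ry| |]; simpl in *; try easy.
    exists ((rx + ry) / 2); lra.
  exists (rx + 1); repeat split; lra.
rewrite <- (Rabs_pos_eq r r0) in hr1, hr2.
apply (CV_disk_outside x r hr1).
apply (is_lim_seq_ext (fun n => scal (pow_n r n) (x n))).
  intros n; rewrite pow_n_pow; unfold scal; simpl; unfold mult; simpl; ring.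
now apply ex_series_lim_0, h.
Qed.

Lemma is_derive_on_circle x th r :
  Rbar_lt (Rabs r) (CV_radius x) ->
  is_derive (fun t => fst (on_circle x th t)) r
    (cos th * fst (on_circle (PS_derive x) th r) - sin th * snd (on_circle (PS_derive x) th r))
  /\ is_derive (fun t => snd (on_circle x th t)) r
    (sin th * fst (on_circle (PS_derive x) th r) + cos th * snd (on_circle (PS_derive x) th r)).
Proof.
intros hr.
assert (hd : Rbar_lt (Rabs r) (CV_radius (PS_derive x))) by now rewrite CV_radius_derive.
assert (ec := CV_radius_inside _ _ (inside_cos _ th _ hd)).
assert (es := CV_radius_inside _ _ (inside_sin _ th _ hd)).
unfold on_circle; cbn [fst snd].
rewrite <- !PSeries_scal, <- PSeries_minus, <- PSeries_plus
  by (apply ex_pseries_scal; [apply Rmult_comm | assumption]).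
split.
- rewrite <- (PSeries_ext (PS_derive (cos_coeff x th))).
    apply is_derive_PSeries, inside_cos, hr.
  intros n; unfold PS_derive, cos_coeff, sin_coeff, PS_minus, PS_plus, PS_opp, PS_scal.
  rewrite S_INR; unfold plus, opp, scal; simpl; unfold mult; simpl.
  replace ((INR n + 1) * th) with (th + INR n * th) by ring; rewrite cos_plus; ring.
- rewrite <- (PSeries_ext (PS_derive (sin_coeff x th))).
    apply is_derive_PSeries, inside_sin, hr.
  intros n; unfold PS_derive, cos_coeff, sin_coeff, PS_minus, PS_plus, PS_opp, PS_scal.
  rewrite S_INR; unfold plus, opp, scal; simpl; unfold mult; simpl.
  replace ((INR n + 1) * th) with (th + INR n * th) by ring; rewrite sin_plus; ring.
Qed.

Lemma is_derive_eq (f : R -> R) (t l l' : R) : is_derive f t l -> l = l' -> is_derive f t l'.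
Proof. now intros h <-. Qed.

(** The derivative of the product of [exp (a + i b)] and [e1 + i e2], in real
    and imaginary parts. *)
Lemma is_derive_exp_mult (a b e1 e2 : R -> R) t a' b' d1 d2 :
  is_derive a t a' -> is_derive b t b' -> is_derive e1 t d1 -> is_derive e2 t d2 ->
  is_derive (fun x => exp (a x) * (cos (b x) * e1 x - sin (b x) * e2 x)) t
    (exp (a t) * (cos (b t) * (a' * e1 t - b' * e2 t + d1)
                  - sin (b t) * (a' * e2 t + b' * e1 t + d2)))
  /\ is_derive (fun x => exp (a x) * (sin (b x) * e1 x + cos (b x) * e2 x)) t
    (exp (a t) * (sin (b t) * (a' * e1 t - b' * e2 t + d1)
                  + cos (b t) * (a' * e2 t + b' * e1 t + d2))).
Proof.
intros da db de1 de2; split; auto_derive; try (repeat split; eexists; eassumption);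
  rewrite (is_derive_unique (fun x : R => a x) _ _ da), (is_derive_unique (fun x : R => b x) _ _ db);
  rewrite (is_derive_unique (fun x : R => e1 x) _ _ de1), (is_derive_unique (fun x : R => e2 x) _ _ de2); ring.
Qed.

Lemma is_derive_affine (f g : R -> R) t f' g' c d :
  is_derive f t f' -> is_derive g t g' ->
  is_derive (fun x => f x - c * g x + x * d) t (f' - c * g' + d).
Proof.
intros df dg; auto_derive; [repeat split; eexists; eassumption|].
rewrite (is_derive_unique (fun x : R => f x) _ _ df), (is_derive_unique (fun x : R => g x) _ _ dg).
ring.
Qed.

Section Branch.
Variable s : R.
Hypothesis hs : 0 < s.

(** [exp_coeff] holds the coefficients of [exp (- V)], and [branch_coeff]
    those of [V]: as [V' = u], they are obtained by integration. *)
Definition u_power (j n : nat) : R := taylor_coeff s n 0 j.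
Definition exp_coeff (n : nat) : R := taylor_coeff s n 1 0.
Definition branch_coeff : nat -> R := PS_Int (u_power 1).
Definition radius : Rbar := CV_radius (u_power 1).

Lemma u_power_0 n : u_power 0 n = match n with O => 1 | _ => 0 end.
Proof. unfold u_power; destruct n; [reflexivity | apply taylor_coeff_00]. Qed.

(** The coefficients of [1] and of [exp (- V)'] are bounded by a multiple of
    those of [u], so these series converge wherever that of [u] does. *)
Lemma radius_dominated x r :
  (forall n, Rabs (x n) <= (1 + s) * Rabs (u_power 1 n)) ->
  Rbar_lt (Rabs r) radius -> Rbar_lt (Rabs r) (CV_radius x).
Proof.
intros hx hr; apply (inside_dominated x (PS_scal (1 + s) (u_power 1))).
  intros n; unfold PS_scal, scal; simpl; unfold mult; simpl.
  rewrite Rabs_mult, (Rabs_pos_eq (1 + s)) by lra; apply hx.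
rewrite CV_radius_scal by lra; exact hr.
Qed.

Lemma u_power_1_0 : u_power 1 0 = / (1 + s).
Proof. unfold u_power; simpl; field; lra. Qed.

Lemma inside_u_power_0 r : Rbar_lt (Rabs r) radius -> Rbar_lt (Rabs r) (CV_radius (u_power 0)).
Proof.
apply radius_dominated; intros n; rewrite u_power_0; destruct n.
  rewrite u_power_1_0, !Rabs_pos_eq; try lra; [right; field; lra|].
  left; apply Rinv_0_lt_compat; lra.
rewrite Rabs_R0; apply Rmult_le_pos; [lra | apply Rabs_pos].
Qed.

Lemma on_circle_u_power_0 th r : Rbar_lt (Rabs r) radius -> on_circle (u_power 0) th r = RtoC 1.
Proof.
intros hr; assert (hr0 := inside_u_power_0 r hr).
unfold on_circle, RtoC; f_equal; rewrite PSeries_decr_1.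
- rewrite (PSeries_ext _ (fun _ => 0)), PSeries_const_0.
    unfold cos_coeff; rewrite u_power_0; simpl; rewrite Rmult_0_l, cos_0; ring.
  intros n; unfold PS_decr_1, cos_coeff; rewrite u_power_0; ring.
- apply CV_radius_inside, inside_cos, hr0.
- rewrite (PSeries_ext _ (fun _ => 0)), PSeries_const_0.
    unfold sin_coeff; rewrite u_power_0; simpl; rewrite Rmult_0_l, sin_0; ring.
  intros n; unfold PS_decr_1, sin_coeff; rewrite u_power_0; ring.
- apply CV_radius_inside, inside_sin, hr0.
Qed.

Lemma u_power_S j n : u_power (S j) n = PS_mult (u_power j) (u_power 1) n.
Proof.
unfold u_power; rewrite taylor_coeff_mult; f_equal; lia.
Qed.

Lemma radius_u_power j : Rbar_le radius (CV_radius (u_power j)).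
Proof.
induction j as [|j IH].
  apply CV_radius_le_of_convergent; intros r hr; apply CV_radius_inside, inside_u_power_0, hr.
apply CV_radius_le_of_convergent; intros r hr.
apply ex_pseries_ext with (PS_mult (u_power j) (u_power 1)).
  intros n; now rewrite u_power_S.
apply ex_pseries_mult; [eapply Rbar_lt_le_trans; [exact hr | exact IH] | exact hr].
Qed.

Lemma on_circle_ext x y th r : (forall n, x n = y n) -> on_circle x th r = on_circle y th r.
Proof.
intros h; unfold on_circle; f_equal; apply PSeries_ext; intros n;
  unfold cos_coeff, sin_coeff; now rewrite h.
Qed.

Lemma on_circle_u_power j th r : Rbar_lt (Rabs r) radius ->
  Cmod (on_circle (u_power j) th r) = Cmod (on_circle (u_power 1) th r) ^ j.
Proof.
intros hr; induction j as [|j IH].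
  rewrite on_circle_u_power_0 by exact hr; apply Cmod_1.
rewrite (on_circle_ext _ _ _ _ (u_power_S j)), on_circle_mult; [|eapply Rbar_lt_le_trans; [exact hr|apply radius_u_power] | exact hr].
rewrite Cmod_mult, IH; simpl; ring.
Qed.

Lemma exp_coeff_derive n :
  PS_derive exp_coeff n = - PS_mult exp_coeff (u_power 1) n.
Proof.
unfold PS_derive, exp_coeff, u_power.
rewrite taylor_coeff_mult, taylor_coeff_S; change (INR 0) with 0; change (INR 1) with 1.
cbn [Nat.add]; ring.
Qed.

Lemma exp_mult_u n :
  PS_mult exp_coeff (u_power 1) n = u_power 0 n - s * u_power 1 n.
Proof.
unfold exp_coeff, u_power; rewrite taylor_coeff_mult; simpl plus.
now apply taylor_coeff_relation.
Qed.

Lemma radius_exp r : Rbar_lt (Rabs r) radius -> Rbar_lt (Rabs r) (CV_radius exp_coeff).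
Proof.
intros hr; rewrite <- CV_radius_derive; revert hr; apply radius_dominated; intros n.
rewrite exp_coeff_derive, exp_mult_u, u_power_0, Rabs_Ropp; destruct n.
  assert (0 < / (1 + s)) by (apply Rinv_0_lt_compat; lra).
  rewrite u_power_1_0; replace (1 - s * / (1 + s)) with (/ (1 + s)) by (field; lra).
  rewrite Rabs_pos_eq by lra.
  rewrite <- (Rmult_1_l (/ _)) at 1; apply Rmult_le_compat_r; lra.
unfold Rminus; rewrite Rplus_0_l, Rabs_Ropp, Rabs_mult, (Rabs_pos_eq s) by lra.
apply Rmult_le_compat_r; [apply Rabs_pos | lra].
Qed.

Lemma branch_coeff_derive n : PS_derive branch_coeff n = u_power 1 n.
Proof.
unfold PS_derive, branch_coeff, PS_Int; field; apply not_0_INR; lia.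
Qed.

Section Ray.
Variable th : R.

Let a t := fst (on_circle branch_coeff th t).
Let b t := snd (on_circle branch_coeff th t).
Let p t := fst (on_circle (u_power 1) th t).
Let q t := snd (on_circle (u_power 1) th t).
Let e1 t := fst (on_circle exp_coeff th t).
Let e2 t := snd (on_circle exp_coeff th t).

Lemma exp_times_u t : Rbar_lt (Rabs t) radius ->
  e1 t * p t - e2 t * q t = 1 - s * p t /\ e1 t * q t + e2 t * p t = - (s * q t).
Proof.
intros ht.
assert (h := on_circle_mult exp_coeff (u_power 1) th t (radius_exp _ ht) ht).
rewrite (on_circle_ext _ _ _ _ exp_mult_u) in h.
assert (h0 := on_circle_u_power_0 th t ht).
assert (c0 := inside_u_power_0 t ht).
assert (k : on_circle (fun n => u_power 0 n - s * u_power 1 n) th t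
   = Cminus (on_circle (u_power 0) th t) (Cmult (RtoC s) (on_circle (u_power 1) th t))).
  unfold on_circle, Cminus, Copp, Cplus, Cmult, RtoC; cbn [fst snd].
  f_equal.
  - transitivity (PSeries (cos_coeff (u_power 0) th) t - s * PSeries (cos_coeff (u_power 1) th) t); [|ring].
    rewrite <- PSeries_scal, <- PSeries_minus.
    + apply PSeries_ext; intros n; unfold PS_minus, PS_plus, PS_opp, PS_scal, cos_coeff.
      unfold plus, opp, scal; simpl; unfold mult; simpl; ring.
    + apply CV_radius_inside, inside_cos, c0.
    + apply ex_pseries_scal; [apply Rmult_comm | apply CV_radius_inside, inside_cos, ht].
  - transitivity (PSeries (sin_coeff (u_power 0) th) t - s * PSeries (sin_coeff (u_power 1) th) t); [|ring].
    rewrite <- PSeries_scal, <- PSeries_minus.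
    + apply PSeries_ext; intros n; unfold PS_minus, PS_plus, PS_opp, PS_scal, sin_coeff.
      unfold plus, opp, scal; simpl; unfold mult; simpl; ring.
    + apply CV_radius_inside, inside_sin, c0.
    + apply ex_pseries_scal; [apply Rmult_comm | apply CV_radius_inside, inside_sin, ht].
rewrite k, h0 in h.
assert (h1 := f_equal fst h); assert (h2 := f_equal snd h).
unfold Cminus, Cplus, Copp, Cmult, RtoC in h1, h2; cbn [fst snd] in h1, h2.
fold (p t) (q t) (e1 t) (e2 t) in h1, h2; split; lra.
Qed.

Lemma derive_branch t : Rbar_lt (Rabs t) radius ->
  is_derive a t (cos th * p t - sin th * q t) /\ is_derive b t (sin th * p t + cos th * q t).
Proof.
intros ht.
assert (h : Rbar_lt (Rabs t) (CV_radius branch_coeff)) by (unfold branch_coeff; rewrite CV_radius_Int; exact ht).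
apply (is_derive_on_circle _ th) in h.
now rewrite (on_circle_ext _ _ _ _ branch_coeff_derive) in h.
Qed.

Lemma derive_exp t : Rbar_lt (Rabs t) radius ->
  is_derive e1 t (- (cos th * (1 - s * p t) + sin th * (s * q t)))
  /\ is_derive e2 t (- (sin th * (1 - s * p t) - cos th * (s * q t))).
Proof.
intros ht.
assert (h := is_derive_on_circle _ th _ (radius_exp _ ht)).
destruct (exp_times_u t ht) as [h1 h2].
assert (k : on_circle (PS_derive exp_coeff) th t = (- (1 - s * p t), s * q t)).
  rewrite (on_circle_ext _ _ _ _ exp_coeff_derive).
  assert (m := on_circle_mult exp_coeff (u_power 1) th t (radius_exp _ ht) ht).
  transitivity (Copp (on_circle (PS_mult exp_coeff (u_power 1)) th t)).
    unfold on_circle, Copp; cbn [fst snd]; rewrite <- !PSeries_opp.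
    f_equal; apply PSeries_ext; intros n; unfold PS_opp, cos_coeff, sin_coeff, opp; simpl; ring.
  rewrite m; unfold Copp, Cmult; cbn [fst snd]; fold (p t) (q t) (e1 t) (e2 t).
  f_equal; lra.
rewrite k in h; cbn [fst snd] in h.
destruct h as [d1 d2]; split.
  replace (- _) with (cos th * - (1 - s * p t) - sin th * (s * q t)) by ring; exact d1.
replace (- _) with (sin th * - (1 - s * p t) + cos th * (s * q t)) by ring; exact d2.
Qed.

Lemma constant_from_0 (f : R -> R) r : 0 <= r ->
  (forall t, 0 <= t <= r -> is_derive f t 0) -> f r = f 0.
Proof.
intros [hr|<-] h; [|reflexivity]; symmetry; now apply (eq_is_derive f 0 r).
Qed.

Lemma on_circle_0 x : on_circle x th 0 = RtoC (x 0%nat).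
Proof.
unfold on_circle, RtoC; rewrite !PSeries_0; unfold cos_coeff, sin_coeff; simpl.
rewrite Rmult_0_l, cos_0, sin_0; f_equal; ring.
Qed.

Lemma branch_0 : a 0 = 0 /\ b 0 = 0.
Proof. unfold a, b; rewrite on_circle_0; unfold branch_coeff, PS_Int; simpl; split; reflexivity. Qed.

Lemma exp_0_value : e1 0 = 1 /\ e2 0 = 0.
Proof. unfold e1, e2; rewrite on_circle_0; unfold exp_coeff; simpl; split; reflexivity. Qed.

(** Write [V] for the sum of [branch_coeff] and [E] for that of [exp_coeff]
    along the ray: [E' = - E V'], so [E exp V] is constant, equal to [1]. *)
Lemma exp_of_branch r : 0 <= r -> Rbar_lt r radius ->
  e1 r = exp (- a r) * cos (b r) /\ e2 r = - (exp (- a r) * sin (b r)).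
Proof.
intros hr0 hr.
assert (hin : forall t, 0 <= t <= r -> Rbar_lt (Rabs t) radius).
  intros t ht; rewrite Rabs_pos_eq by lra; eapply Rbar_le_lt_trans; [|exact hr]; apply ht.
assert (k1 : exp (a r) * (cos (b r) * e1 r - sin (b r) * e2 r) = 1).
  rewrite (constant_from_0 (fun t => exp (a t) * (cos (b t) * e1 t - sin (b t) * e2 t)) r hr0).
    destruct branch_0 as [-> ->]; destruct exp_0_value as [-> ->].
    rewrite exp_0, cos_0, sin_0; ring.
  intros t ht; assert (it := hin t ht).
  destruct (derive_branch t it) as [da db]; destruct (derive_exp t it) as [d1 d2].
  destruct (exp_times_u t it) as [h1 h2].
  destruct (is_derive_exp_mult a b e1 e2 t _ _ _ _ da db d1 d2) as [c1 c2].
  eapply is_derive_eq; [exact c1|].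
  replace (s * q t) with (- (e1 t * q t + e2 t * p t)) by lra.
  replace (1 - s * p t) with (e1 t * p t - e2 t * q t) by lra.
  ring.
assert (k2 : exp (a r) * (sin (b r) * e1 r + cos (b r) * e2 r) = 0).
  rewrite (constant_from_0 (fun t => exp (a t) * (sin (b t) * e1 t + cos (b t) * e2 t)) r hr0).
    destruct branch_0 as [-> ->]; destruct exp_0_value as [-> ->].
    rewrite exp_0, cos_0, sin_0; ring.
  intros t ht; assert (it := hin t ht).
  destruct (derive_branch t it) as [da db]; destruct (derive_exp t it) as [d1 d2].
  destruct (exp_times_u t it) as [h1 h2].
  destruct (is_derive_exp_mult a b e1 e2 t _ _ _ _ da db d1 d2) as [c1 c2].
  eapply is_derive_eq; [exact c2|].
  replace (s * q t) with (- (e1 t * q t + e2 t * p t)) by lra.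
  replace (1 - s * p t) with (e1 t * p t - e2 t * q t) by lra.
  ring.
assert (cs := sin2_cos2 (b r)); unfold Rsqr in cs.
rewrite exp_Ropp; assert (he := exp_pos (a r)).
assert (k3 : cos (b r) * e1 r - sin (b r) * e2 r = / exp (a r)).
  apply Rmult_eq_reg_l with (exp (a r)); [|lra]; rewrite k1; field; lra.
assert (k4 : sin (b r) * e1 r + cos (b r) * e2 r = 0).
  apply Rmult_eq_reg_l with (exp (a r)); [|lra]; rewrite k2; ring.
rewrite <- k3; split.
- assert (e : e1 r * (sin (b r) * sin (b r) + cos (b r) * cos (b r))
     = (cos (b r) * e1 r - sin (b r) * e2 r) * cos (b r)
       + sin (b r) * (sin (b r) * e1 r + cos (b r) * e2 r)) by ring.
  rewrite cs, k4 in e; lra.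
- assert (e : e2 r * (sin (b r) * sin (b r) + cos (b r) * cos (b r))
     = - ((cos (b r) * e1 r - sin (b r) * e2 r) * sin (b r))
       + cos (b r) * (sin (b r) * e1 r + cos (b r) * e2 r)) by ring.
  rewrite cs, k4 in e; lra.
Qed.

(** With [V] and [E] as above, [E u = 1 - s u] gives [E' = s V' - 1], so
    [E - s V + tau] is constant. *)
Lemma exp_of_branch_linear r : 0 <= r -> Rbar_lt r radius ->
  e1 r = 1 - r * cos th + s * a r /\ e2 r = - (r * sin th) + s * b r.
Proof.
intros hr0 hr.
assert (hin : forall t, 0 <= t <= r -> Rbar_lt (Rabs t) radius).
  intros t ht; rewrite Rabs_pos_eq by lra; eapply Rbar_le_lt_trans; [|exact hr]; apply ht.
destruct branch_0 as [a0 b0]; destruct exp_0_value as [e10 e20].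
assert (k1 := constant_from_0 (fun t => e1 t - s * a t + t * cos th) r hr0).
assert (k2 := constant_from_0 (fun t => e2 t - s * b t + t * sin th) r hr0).
cbv beta in k1, k2; rewrite a0, e10 in k1; rewrite b0, e20 in k2.
split.
- cut (e1 r - s * a r + r * cos th = 1 - s * 0 + 0 * cos th); [lra|].
  apply k1; intros t ht; assert (it := hin t ht).
  destruct (derive_branch t it) as [da db]; destruct (derive_exp t it) as [d1 d2].
  eapply is_derive_eq; [exact (is_derive_affine e1 a t _ _ s (cos th) d1 da)|].
  ring.
- cut (e2 r - s * b r + r * sin th = 0 - s * 0 + 0 * sin th); [lra|].
  apply k2; intros t ht; assert (it := hin t ht).
  destruct (derive_branch t it) as [da db]; destruct (derive_exp t it) as [d1 d2].
  eapply is_derive_eq; [exact (is_derive_affine e2 b t _ _ s (sin th) d2 db)|].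
  ring.
Qed.

(** Along the ray of direction [th], and inside the disc of convergence,
    [f (V tau) = tau] and [f' (V tau) * u tau = 1], where [V = a + i b]. *)
Lemma branch_inverse r : 0 <= r -> Rbar_lt r radius ->
  s * a r + 1 - exp (- a r) * cos (b r) = r * cos th
  /\ s * b r + exp (- a r) * sin (b r) = r * sin th
  /\ Cmult (s + exp (- a r) * cos (b r), - (exp (- a r) * sin (b r)))
           (on_circle (u_power 1) th r) = RtoC 1.
Proof.
intros hr0 hr.
destruct (exp_of_branch r hr0 hr) as [h1 h2].
destruct (exp_of_branch_linear r hr0 hr) as [h3 h4].
destruct (exp_times_u r) as [h5 h6]; [now rewrite Rabs_pos_eq|].
repeat split; [lra|lra|].
rewrite <- h2, <- h1; unfold Cmult, RtoC; cbn [fst snd]; fold (p r) (q r); f_equal; lra.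
Qed.
End Ray.
End Branch.

(** * The radius of convergence *)
Lemma mul_cos_lt_sin t : 0 < t < PI -> t * cos t < sin t.
Proof.
intros [h0 hpi].
assert (0 * 1 < sin t - t * cos t); [|lra].
destruct (MVT_cor2 (fun x => sin x - x * cos x) (fun x => x * sin x) 0 t h0) as [c [hc hc']].
  intros c _; apply is_derive_Reals; auto_derive; [exact I|ring].
rewrite sin_0 in hc.
assert (0 < c * sin c) by (apply Rmult_lt_0_compat; [lra|apply sin_gt_0; lra]).
assert (0 < c * sin c * (t - 0)) by (apply Rmult_lt_0_compat; lra).
lra.
Qed.

Lemma critical_modulus_sq s : 0 < s ->
  (s * g s) ^ 2 = (s + 1 - s * ln s) ^ 2 + (s * PI) ^ 2.
Proof.
intros hs; unfold g; rewrite Rpow_mult_distr, pow2_sqrt; [field; lra|].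
assert (h := pow2_ge_0 PI); assert (h' := pow2_ge_0 (1 + / s - ln s)); lra.
Qed.

Lemma g_pos s : 0 < g s.
Proof.
unfold g; apply sqrt_lt_R0.
assert (h := pow_lt PI 2 PI_RGT_0); assert (h' := pow2_ge_0 (1 + / s - ln s)); lra.
Qed.

(** If [f' v] is small, then [exp (- v)] is close to [- s], so [v] is close
    to one of the critical points and [f v] is close to a critical value.
    All critical values have modulus at least [s * g s].  As [|f v|] is only
    to be bounded from below, it suffices that [|b|] is not much less than
    [PI]; which odd multiple of [PI] is close to [b] does not matter. *)
Lemma derivative_bounded_below s R0 : 0 < s -> 0 <= R0 < s * g s ->
  exists d, 0 < d /\ forall a b,
    (s * a + 1 - exp (- a) * cos b) ^ 2 + (s * b + exp (- a) * sin b) ^ 2 <= R0 ^ 2 ->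
    d <= Cmod (s + exp (- a) * cos b, - (exp (- a) * sin b)).
Proof.
intros hs [hR0 hR].
(* [|f v|] falls short of [s * g s] by at most [6 d]. *)
exists (Rmin (s / 2) ((s * g s - R0) / 12)).
set (d := Rmin _ _).
assert (d1 : d <= s / 2) by apply Rmin_l.
assert (d2 : d <= (s * g s - R0) / 12) by apply Rmin_r.
assert (d0 : 0 < d) by (apply Rmin_glb_lt; lra).
split; [exact d0|]; intros a b hf.
apply Rnot_lt_le; intros hlt.
set (E := exp (- a)) in *; assert (hE : 0 < E) by apply exp_pos.
assert (cs := sin2_cos2 b); unfold Rsqr in cs.
assert (hre : Rabs (s + E * cos b) < d).
  eapply Rle_lt_trans; [|exact hlt]; apply (Rle_trans _ _ _ (Rmax_l _ _) (Rmax_Cmod (_, _))).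
assert (him : Rabs (- (E * sin b)) < d).
  eapply Rle_lt_trans; [|exact hlt]; apply (Rle_trans _ _ _ (Rmax_r _ _) (Rmax_Cmod (_, _))).
apply Rabs_def2 in hre; apply Rabs_def2 in him.
assert (hc : cos b < 0) by nra.
assert (E2 : E ^ 2 = (E * cos b) ^ 2 + (E * sin b) ^ 2).
  replace ((E * cos b) ^ 2 + (E * sin b) ^ 2) with (E ^ 2 * (sin b * sin b + cos b * cos b)) by ring.
  rewrite cs; ring.
assert (E_lo : s - d < E) by nra.
assert (E_hi : E < s + 2 * d) by nra.
assert (lnE : ln E = - a) by apply ln_exp.
assert (ln_le : forall u, 0 < u -> ln u <= u - 1).
  intros u hu; rewrite <- (ln_exp (u - 1)); apply ln_le; [exact hu|].
  assert (h := exp_ineq1_le (u - 1)); lra.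
assert (a_hi : s * (- ln s - a) <= 2 * d).
  assert (h := ln_le (E / s) (Rdiv_lt_0_compat _ _ hE hs)).
  unfold Rdiv in h; rewrite ln_mult, ln_Rinv, lnE in h by (try apply Rinv_0_lt_compat; lra).
  assert (e : s * (E * / s - 1) = E - s) by (field; lra).
  assert (s * (- a + - ln s) <= s * (E * / s - 1)) by (apply Rmult_le_compat_l; lra).
  lra.
assert (a_lo : - (2 * d) <= s * (- ln s - a)).
  assert (h := ln_le (s / E) (Rdiv_lt_0_compat _ _ hs hE)).
  unfold Rdiv in h; rewrite ln_mult, ln_Rinv, lnE in h by (try apply Rinv_0_lt_compat; lra).
  assert (e : s * / E - 1 = (s - E) / E) by (field; lra).
  assert (s * (ln s + a) <= s * ((s - E) / E)) by (apply Rmult_le_compat_l; lra).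
  assert (s * ((s - E) / E) <= 2 * d); [|lra].
  apply Rmult_le_reg_r with E; [exact hE|].
  replace (s * ((s - E) / E) * E) with (s * (s - E)) by (field; lra); nra.
assert (b_lo : s * PI - 2 * d <= s * Rabs b).
  destruct (Rle_lt_dec PI (Rabs b)) as [h|h].
    assert (s * PI <= s * Rabs b) by (apply Rmult_le_compat_l; lra); lra.
  assert (cb : cos (Rabs b) = cos b).
    unfold Rabs; destruct (Rcase_abs b); [apply cos_neg|reflexivity].
  assert (sb : E * sin (Rabs b) < d).
    unfold Rabs; destruct (Rcase_abs b); [rewrite sin_neg|]; lra.
  assert (b0 := Rabs_pos b).
  assert (b1 : 0 < Rabs b).
    destruct b0 as [b0|b0]; [exact b0|]; rewrite <- b0, cos_0 in cb; lra.
  assert (hb := mul_cos_lt_sin (PI - Rabs b) ltac:(lra)).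
  rewrite sin_PI_x, Rtrigo_facts.cos_pi_minus, cb in hb.
  assert (E * ((PI - Rabs b) * - cos b) < E * sin (Rabs b)) by (apply Rmult_lt_compat_l; assumption).
  assert ((PI - Rabs b) * (s / 2) <= (PI - Rabs b) * (E * - cos b)) by (apply Rmult_le_compat_l; lra).
  lra.
set (X := s * a + 1 - E * cos b) in *; set (Y := s * b + E * sin b) in *.
assert (hY : s * PI <= Rabs Y + 3 * d).
  assert (Rabs (s * b) <= Rabs Y + Rabs (- (E * sin b))).
    replace (s * b) with (Y + - (E * sin b)) by (unfold Y; ring); apply Rabs_triang.
  rewrite Rabs_mult, (Rabs_pos_eq s) in H by lra.
  assert (Rabs (- (E * sin b)) <= d) by (apply Rabs_le; lra); lra.
assert (hX : Rabs (s + 1 - s * ln s) <= Rabs X + 3 * d).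
  replace (s + 1 - s * ln s) with (X + (s + E * cos b + s * (- ln s - a))) by (unfold X; ring).
  eapply Rle_trans; [apply Rabs_triang|]; apply Rplus_le_compat_l, Rabs_le; lra.
assert (crit := critical_modulus_sq s hs).
rewrite <- (pow2_abs (s + 1 - s * ln s)) in crit.
rewrite <- (pow2_abs X), <- (pow2_abs Y) in hf.
assert (x0 := Rabs_pos X); assert (y0 := Rabs_pos Y); assert (p0 := Rabs_pos (s + 1 - s * ln s)).
assert (xR : Rabs X <= R0) by (apply Rsqr_incr_0; unfold Rsqr; nra).
assert (yR : Rabs Y <= R0) by (apply Rsqr_incr_0; unfold Rsqr; nra).
assert (hpi : 0 <= s * PI) by (apply Rmult_le_pos; [lra|left; apply PI_RGT_0]).
assert (k1 : Rabs (s + 1 - s * ln s) ^ 2 <= (Rabs X + 3 * d) ^ 2) by (apply pow_incr; lra).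
assert (k2 : (s * PI) ^ 2 <= (Rabs Y + 3 * d) ^ 2) by (apply pow_incr; lra).
assert (k3 : (R0 + 6 * d) ^ 2 < (s * g s) ^ 2).
  assert (R0 + 6 * d < s * g s) by lra. nra.
nra.
Qed.

Lemma radius_gt_of_bound s R0 U : 0 < s -> 0 <= R0 -> 0 < U ->
  (forall j n, Rabs (u_power s j n) * R0 ^ n <= U ^ j) ->
  Rbar_lt R0 (radius s).
Proof.
intros hs hR hU hb.
set (K := U + s * U ^ 2).
assert (hK : 0 < K) by (unfold K; assert (0 <= s * U ^ 2) by (apply Rmult_le_pos; [lra|apply pow2_ge_0]); lra).
assert (hK' : 0 < / (4 * K)) by (apply Rinv_0_lt_compat; lra).
apply Rbar_lt_le_trans with (R0 + / (4 * K)); [simpl; lra|].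
destruct (CV_radius_bounded (u_power s 1)) as [ub _].
apply ub; exists (2 * U); intros n.
rewrite Rabs_mult, (Rabs_pos_eq (_ ^ n)) by (apply pow_le; lra).
exact (taylor_coeff_growth s R0 U hs hR hU hb n).
Qed.

Lemma radius_pos s : 0 < s -> Rbar_lt 0 (radius s).
Proof.
intros hs; assert (hz : 0 < / (1 + s)) by (apply Rinv_0_lt_compat; lra).
apply (radius_gt_of_bound s 0 (/ (1 + s))); try lra.
intros j [|n]; [|rewrite pow_i by lia; rewrite Rmult_0_r; apply pow_le; lra].
unfold u_power; simpl; rewrite Rmult_1_r, Rabs_pos_eq by (apply pow_le; lra); lra.
Qed.

Lemma left_limit_pow A B R0 n : 0 < R0 ->
  (forall r, 0 <= r < R0 -> A * r ^ n <= B) -> A * R0 ^ n <= B.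
Proof.
intros hR h; apply Rnot_lt_le; intros hlt.
assert (c : continuity_pt (fun r => A * r ^ n) R0).
  apply derivable_continuous_pt, ex_derive_Reals_0; auto_derive; exact I.
destruct (c (A * R0 ^ n - B)) as [d [d0 hd]]; [lra|].
assert (m1 := Rmin_l d R0); assert (m2 := Rmin_r d R0).
assert (m0 : 0 < Rmin d R0) by (apply Rmin_glb_lt; lra).
specialize (hd (R0 - Rmin d R0 / 2)); simpl in hd; unfold R_dist, D_x, no_cond in hd.
assert (hr := h (R0 - Rmin d R0 / 2) ltac:(lra)).
assert (Rabs (A * (R0 - Rmin d R0 / 2) ^ n - A * R0 ^ n) < A * R0 ^ n - B).
  apply hd; split; [split; [exact I|lra]|].
  replace (R0 - Rmin d R0 / 2 - R0) with (- (Rmin d R0 / 2)) by ring.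
  rewrite Rabs_Ropp, Rabs_pos_eq; lra.
apply Rabs_def2 in H; lra.
Qed.

(** At the radius [R0] the bounds on [u] pass from the smaller circles to the
    limit, and the coefficient bound then beats [R0]. *)
Lemma radius_ge s : 0 < s -> Rbar_le (s * g s) (radius s).
Proof.
intros hs; apply Rbar_not_lt_le; intros hlt.
assert (hp := radius_pos s hs).
destruct (radius s) as [R0| |] eqn:eR; try easy; simpl in hlt, hp.
destruct (derivative_bounded_below s R0 hs ltac:(lra)) as [d [d0 hd]].
assert (Rbar_lt R0 (radius s)) as h; [|rewrite eR in h; simpl in h; lra].
apply (radius_gt_of_bound s R0 (/ d)); [exact hs|lra|now apply Rinv_0_lt_compat|].
intros j n; apply left_limit_pow; [exact hp|]; intros r hr.
assert (hr' : Rbar_lt r (radius s)) by (rewrite eR; apply hr).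
assert (hra : Rbar_lt (Rabs r) (radius s)) by now rewrite Rabs_pos_eq.
apply cauchy_estimate; [apply hr| |].
  eapply Rbar_lt_le_trans; [exact hr'|now apply radius_u_power].
intros th; rewrite on_circle_u_power by assumption.
apply pow_incr; split; [apply Cmod_ge_0|].
destruct (branch_inverse s hs th r (proj1 hr) hr') as [h1 [h2 h3]].
set (a := fst _) in *; set (b := snd _) in *.
assert (m := f_equal Cmod h3); rewrite Cmod_mult, Cmod_1 in m.
assert (hdm := hd a b).
assert (hm : d <= Cmod (s + exp (- a) * cos b, - (exp (- a) * sin b))).
  apply hdm; rewrite h1, h2.
  replace ((r * cos th) ^ 2 + (r * sin th) ^ 2) with (r ^ 2 * (sin th * sin th + cos th * cos th)) by ring.
  assert (cs := sin2_cos2 th); unfold Rsqr in cs; rewrite cs, Rmult_1_r.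
  apply pow_incr; lra.
assert (c0 := Cmod_ge_0 (on_circle (u_power s 1) th r)).
apply Rmult_le_reg_l with d; [exact d0|]; rewrite Rinv_r by lra.
rewrite <- m; apply Rmult_le_compat_r; assumption.
Qed.

Lemma crosses_level (f : R -> R) r c : 0 <= r ->
  (forall t, 0 <= t <= r -> continuity_pt f t) -> f 0 < c -> c < f r ->
  exists t, 0 <= t < r /\ f t = c.
Proof.
intros hr hc h0 h1.
assert (r <> 0) by (intros ->; lra).
destruct (IVT_interv (fun t => f t - c) 0 r) as [t [ht e]]; try lra.
  intros t ht; apply continuity_pt_minus; [now apply hc|apply continuity_pt_const; easy].
exists t; split; [|lra].
destruct ht as [ht0 [ht1|ht1]]; [lra|subst t; lra].
Qed.

(** With [b = PI - t] and [exp (- a) = s exp y], the two equations become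
    [exp y cos t = 1 + y] and [exp y sin t = t].  For [0 < t < PI] the second
    forces [y > 0], since [sin t < t]; but [t cos t < sin t] turns both into
    [y < 0].  The value [t = PI] contradicts the second equation, and
    [b < 0] makes the imaginary part of [f] negative.  So [t = 0], and
    [exp y = 1 + y] gives [y = 0]. *)
Lemma only_preimage_in_strip s a b : 0 < s -> - PI <= b <= PI ->
  s * a + 1 - exp (- a) * cos b = s + 1 - s * ln s ->
  s * b + exp (- a) * sin b = s * PI ->
  b = PI /\ exp (- a) = s.
Proof.
intros hs hb h1 h2; assert (hpi := PI_RGT_0).
set (y := - ln s - a).
assert (eE : exp (- a) = s * exp y).
  unfold y; replace (- ln s - a) with (- a + - ln s) by ring.
  rewrite exp_plus, exp_Ropp, (exp_Ropp (ln s)), exp_ln by exact hs; field; split; [lra|apply Rgt_not_eq, exp_pos].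
assert (hy := exp_pos y).
rewrite eE in h1, h2 |- *.
assert (ea : a = - ln s - y) by (unfold y; ring).
destruct (Rlt_or_le b 0) as [bneg|bpos].
  assert (sin b <= 0).
    destruct (Req_dec b (- PI)) as [->|hne]; [rewrite sin_neg, sin_PI; lra|].
    left; rewrite <- (Ropp_involutive b), sin_neg.
    assert (0 < sin (- b)) by (apply sin_gt_0; lra); lra.
  assert (0 < s * PI) by now apply Rmult_lt_0_compat.
  assert (0 < s * exp y) by now apply Rmult_lt_0_compat.
  nra.
destruct (proj2 hb) as [blt| ->].
- exfalso.
  set (t := PI - b); assert (eb : b = PI - t) by (unfold t; ring).
  rewrite eb, Rtrigo_facts.cos_pi_minus in h1; rewrite eb, sin_PI_x in h2.
  assert (k2 : exp y * sin t = t) by (apply Rmult_eq_reg_l with s; lra).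
  assert (k1 : exp y * cos t = 1 + y) by (apply Rmult_eq_reg_l with s; [|lra]; rewrite ea in h1; lra).
  assert (t0 : 0 < t) by (unfold t; lra).
  assert (tpi : t < PI).
    destruct (Req_dec t PI) as [e|hne]; [rewrite e, sin_PI in k2; lra|unfold t in *; lra].
  assert (k3 := mul_cos_lt_sin t ltac:(lra)).
  assert (k4 : exp y * (t * cos t) < exp y * sin t) by now apply Rmult_lt_compat_l.
  assert (yneg : y < 0) by nra.
  assert (k5 := sin_lt_x t t0).
  assert (exp y < 1) by (rewrite <- exp_0; now apply exp_increasing).
  assert (s0 : 0 < sin t) by (apply sin_gt_0; lra).
  nra.
- split; [reflexivity|].
  rewrite cos_PI in h1.
  assert (k : exp y = 1 + y) by (apply Rmult_eq_reg_l with s; [|lra]; rewrite ea in h1; lra).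
  destruct (Req_dec y 0) as [->|hne]; [rewrite exp_0; ring|].
  assert (h := exp_ineq1 y hne); lra.
Qed.

(** Along the segment from [0] to the critical value, [Im f] lies strictly
    between [- s PI] and [s PI] before the end point, so [Im V] cannot reach
    [PI] or [- PI] earlier.  At the end point [V] is the critical point, where
    [f' V * u = 1] is impossible. *)
Lemma radius_le s : 0 < s -> Rbar_le (radius s) (s * g s).
Proof.
intros hs; apply Rbar_not_lt_le; intros hlt.
assert (hpi := PI_RGT_0); assert (hg := g_pos s).
set (r0 := s * g s) in *; assert (r0pos : 0 < r0) by now apply Rmult_lt_0_compat.
assert (crit := critical_modulus_sq s hs); fold r0 in crit.
assert (sp : 0 < s * PI) by now apply Rmult_lt_0_compat.
assert (exists th, r0 * cos th = s + 1 - s * ln s /\ r0 * sin th = s * PI) as [th [hc hsn]].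
  set (P := s + 1 - s * ln s) in *.
  assert (hP : -1 <= P / r0 <= 1).
    split; apply Rmult_le_reg_r with r0; try lra; unfold Rdiv; rewrite Rmult_assoc, Rinv_l by lra; nra.
  exists (acos (P / r0)); rewrite cos_acos, sin_acos by exact hP; split; [field; lra|].
  rewrite <- (sqrt_pow2 r0) at 1 by lra; rewrite <- sqrt_mult_alt by apply pow2_ge_0.
  rewrite <- (sqrt_pow2 (s * PI)) by lra; f_equal.
  unfold Rsqr; replace (r0 ^ 2 * (1 - P / r0 * (P / r0))) with (r0 ^ 2 - P ^ 2) by (field; lra); lra.
assert (hin : forall t, 0 <= t <= r0 -> Rbar_lt t (radius s)).
  intros t ht; eapply Rbar_le_lt_trans; [|exact hlt]; apply ht.
set (b := fun t => snd (on_circle (branch_coeff s) th t)).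
assert (cb : forall t, 0 <= t <= r0 -> continuity_pt b t).
  intros t ht; apply continuity_pt_filterlim, (ex_derive_continuous b).
  eexists; apply (derive_branch s th t).
  rewrite Rabs_pos_eq by lra; now apply hin.
assert (b0 : b 0 = 0) by apply (branch_0 s th).
assert (never : forall t, 0 <= t < r0 -> b t <> PI /\ b t <> - PI).
  intros t ht; destruct (branch_inverse s hs th t (proj1 ht) (hin t ltac:(lra))) as [_ [h2 _]].
  fold (b t) in h2.
  assert (t * sin th < s * PI) by (rewrite <- hsn; apply Rmult_lt_compat_r; nra).
  assert (0 <= t * sin th) by (apply Rmult_le_pos; nra).
  split; intros e; rewrite e, ?sin_neg, sin_PI in h2; lra.
assert (hb : - PI <= b r0 <= PI).
  split; apply Rnot_lt_le; intros h.
  - destruct (crosses_level (fun t => - b t) r0 PI) as [t [ht e]]; try lra.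
      intros t ht; now apply continuity_pt_opp, cb.
    apply (proj2 (never t ht)); lra.
  - destruct (crosses_level b r0 PI) as [t [ht e]]; try lra; [exact cb|].
    now apply (proj1 (never t ht)).
destruct (branch_inverse s hs th r0 (Rlt_le _ _ r0pos) (hin r0 ltac:(lra))) as [h1 [h2 h3]].
fold (b r0) in h1, h2, h3.
set (a := fst (on_circle (branch_coeff s) th r0)) in *.
rewrite hc in h1; rewrite hsn in h2.
destruct (only_preimage_in_strip s a (b r0) hs hb h1 h2) as [eb ea].
rewrite eb, ea, cos_PI, sin_PI in h3.
replace (s + s * -1, - (s * 0)) with (RtoC 0) in h3 by (unfold RtoC; f_equal; ring).
rewrite Cmult_0_l in h3; apply (f_equal fst) in h3; simpl in h3; lra.
Qed.

Lemma radius_eq s : 0 < s -> radius s = s * g s.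
Proof. intros hs; apply Rbar_le_antisym; [now apply radius_le | now apply radius_ge]. Qed.

(** * Convergence of the series *)
Lemma series_converges_iff alpha x : let s := sigma_of alpha x in
  series_converges alpha x <-> ex_series (fun n => branch_coeff s n * tau_of alpha x ^ n).
Proof.
intros s.
transitivity (ex_series (fun n => branch_coeff s (S n) * tau_of alpha x ^ S n)).
  split; intros [l hl]; exists l.
    apply is_series_Reals in hl; revert hl; apply is_series_ext.
    intros n; rewrite series_term_taylor; reflexivity.
  apply is_series_Reals; revert hl; apply is_series_ext.
  intros n; rewrite series_term_taylor; reflexivity.
symmetry; apply (ex_series_incr_1 (fun n => branch_coeff s n * tau_of alpha x ^ n)).
Qed.

Lemma tau_of_sigma alpha x : 0 < alpha -> 1 < x ->
  tau_of alpha x = sigma_of alpha x * (ln alpha - ln (sigma_of alpha x)).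
Proof.
intros ha hx; assert (hl : 0 < ln x) by (rewrite <- ln_1; apply ln_increasing; lra).
unfold tau_of, sigma_of, Rdiv; rewrite ln_mult, ln_Rinv by (try apply Rinv_0_lt_compat; lra).
field; lra.
Qed.

Lemma sigma_of_pos alpha x : 0 < alpha -> 1 < x -> 0 < sigma_of alpha x.
Proof.
intros ha hx; apply Rdiv_lt_0_compat; [exact ha|].
rewrite <- ln_1; apply ln_increasing; lra.
Qed.

Lemma series_converges_inside alpha x : 0 < alpha -> 1 < x ->
  Rabs (ln alpha - ln (sigma_of alpha x)) < g (sigma_of alpha x) -> series_converges alpha x.
Proof.
intros ha hx h; assert (hs := sigma_of_pos alpha x ha hx).
apply series_converges_iff.
apply (ex_series_ext (fun n => scal (pow_n (tau_of alpha x) n) (branch_coeff (sigma_of alpha x) n))).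
  intros n; rewrite pow_n_pow; unfold scal; simpl; unfold mult; simpl; ring.
apply (CV_radius_inside (branch_coeff _)).
unfold branch_coeff; rewrite CV_radius_Int; fold (radius (sigma_of alpha x)).
rewrite radius_eq, tau_of_sigma, Rabs_mult, (Rabs_pos_eq (sigma_of alpha x)) by lra.
now apply Rmult_lt_compat_l.
Qed.

Lemma series_diverges_outside alpha x : 0 < alpha -> 1 < x ->
  g (sigma_of alpha x) < Rabs (ln alpha - ln (sigma_of alpha x)) -> ~ series_converges alpha x.
Proof.
intros ha hx h; assert (hs := sigma_of_pos alpha x ha hx).
intros hcv; apply series_converges_iff in hcv.
apply (CV_disk_outside (branch_coeff (sigma_of alpha x)) (tau_of alpha x)); [|now apply ex_series_lim_0].
unfold branch_coeff; rewrite CV_radius_Int; fold (radius (sigma_of alpha x)).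
rewrite radius_eq, tau_of_sigma, Rabs_mult, (Rabs_pos_eq (sigma_of alpha x)) by lra.
now apply Rmult_lt_compat_l.
Qed.

(** * Monotonicity of ln - g and ln + g *)
Definition one_plus_inv (s : R) : R := 1 + / s.
(** The critical values of [f] of least modulus are
    [s (crit_re s + i PI)] and its conjugate. *)
Definition crit_re (s : R) : R := 1 + / s - ln s.
Definition log_lower (s : R) : R := ln s - g s.
Definition log_upper (s : R) : R := ln s + g s.

Lemma g_sq s : g s ^ 2 = PI ^ 2 + crit_re s ^ 2.
Proof.
unfold g; rewrite pow2_sqrt; [reflexivity|].
assert (h := pow2_ge_0 PI); assert (h' := pow2_ge_0 (1 + / s - ln s)); lra.
Qed.

Lemma q_gt_1 s : 0 < s -> 1 < one_plus_inv s.
Proof. intros hs; unfold one_plus_inv; assert (h := Rinv_0_lt_compat s hs); lra. Qed.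

Lemma lt_of_sq_lt x y : 0 <= y -> x ^ 2 < y ^ 2 -> x < y.
Proof. intros hy h; apply Rnot_le_lt; intros hle; assert (y ^ 2 <= x ^ 2) by (apply pow_incr; lra); lra. Qed.

Lemma is_derive_g s : 0 < s -> is_derive g s (- (one_plus_inv s * crit_re s / (s * g s))).
Proof.
intros hs; assert (hg := g_pos s); assert (e := g_sq s).
assert (h0 : 0 < PI ^ 2 + (1 + / s - ln s) ^ 2) by (unfold crit_re in e; rewrite <- e; apply pow_lt, hg).
unfold g; auto_derive.
  simpl in h0; repeat split; try lra.
fold (g s); unfold one_plus_inv, crit_re.
match goal with |- context [sqrt ?u] => replace (sqrt u) with (g s) by (unfold g; f_equal; ring) end.
field; lra.
Qed.

Lemma is_derive_log_lower s : 0 < s ->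
  is_derive log_lower s ((g s + one_plus_inv s * crit_re s) / (s * g s)).
Proof.
intros hs; assert (hg := g_pos s); assert (dg := is_derive_g s hs).
eapply is_derive_eq.
  apply (is_derive_minus ln g); [apply is_derive_Reals, derivable_pt_lim_ln, hs|exact dg].
unfold minus, plus, opp; simpl; field; lra.
Qed.

Lemma is_derive_log_upper s : 0 < s ->
  is_derive log_upper s ((g s - one_plus_inv s * crit_re s) / (s * g s)).
Proof.
intros hs; assert (hg := g_pos s); assert (dg := is_derive_g s hs).
eapply is_derive_eq.
  apply (is_derive_plus ln g); [apply is_derive_Reals, derivable_pt_lim_ln, hs|exact dg].
unfold minus, plus, opp; simpl; field; lra.
Qed.

Lemma PI_sq_gt_8 : 8 < PI ^ 2.
Proof. assert (h := PI2_3_2); assert (3 < PI) by lra; nra. Qed.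

(** Only [crit_re s < 0] is at stake, that is [ln s > 1 + / s].  With
    [r = sqrt s] and [ln r <= r - 1] one gets [crit_re s ^ 2 <= 4 s - 9], whence
    [crit_re s ^ 2 ((1 + / s) ^ 2 - 1) < 8 < PI ^ 2]. *)
Lemma log_lower_slope_pos s : 0 < s -> 0 < g s + one_plus_inv s * crit_re s.
Proof.
intros hs; assert (hg := g_pos s); assert (e := g_sq s); assert (hq := q_gt_1 s hs).
assert (hi := Rinv_0_lt_compat s hs); assert (pi8 := PI_sq_gt_8).
destruct (Rle_or_lt 0 (crit_re s)) as [h|h].
  assert (0 <= one_plus_inv s * crit_re s) by (apply Rmult_le_pos; lra); lra.
cut (one_plus_inv s * - crit_re s < g s); [lra|].
apply lt_of_sq_lt; [lra|]; rewrite e.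
set (r := sqrt s); assert (r0 : 0 < r) by now apply sqrt_lt_R0.
assert (er : s = r ^ 2) by (unfold r; rewrite pow2_sqrt; lra).
assert (lnr : ln r <= r - 1).
  rewrite <- (ln_exp (r - 1)); apply ln_le; [exact r0|].
  assert (k := exp_ineq1_le (r - 1)); lra.
assert (lns : ln s = 2 * ln r) by (rewrite er, <- Rpower_pow, ln_Rpower by exact r0; simpl; ring).
assert (hle : - crit_re s <= 2 * r - 3) by (unfold crit_re; lra).
assert (k1 : crit_re s ^ 2 <= 4 * r ^ 2 - 9).
  assert ((- crit_re s) ^ 2 <= (2 * r - 3) ^ 2) by (apply pow_incr; lra); nra.
assert (ri : / s * r ^ 2 = 1) by (rewrite er; field; lra).
set (i := / s) in *.
assert (k2 : crit_re s ^ 2 * (2 * i + i ^ 2) < 8).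
  apply Rle_lt_trans with ((4 * r ^ 2 - 9) * (2 * i + i ^ 2)).
    apply Rmult_le_compat_r; [|exact k1]; assert (0 <= i ^ 2) by apply pow2_ge_0; lra.
  replace ((4 * r ^ 2 - 9) * (2 * i + i ^ 2)) with
    (8 * (i * r ^ 2) + 4 * i * (i * r ^ 2) - 18 * i - 9 * i ^ 2) by ring.
  rewrite ri; assert (0 <= i ^ 2) by apply pow2_ge_0; lra.
unfold one_plus_inv; fold i; nra.
Qed.

Lemma mvt_pos (f f' : R -> R) x y : x < y ->
  (forall c, x <= c <= y -> is_derive f c (f' c)) ->
  (forall c, x < c < y -> 0 < f' c) -> f x < f y.
Proof.
intros hxy hd hp; destruct (MVT_cor2 f f' x y hxy) as [c [e hc]].
  intros c hc; apply is_derive_Reals, hd, hc.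
assert (0 < f' c * (y - x)) by (apply Rmult_lt_0_compat; [now apply hp|lra]); lra.
Qed.

Lemma log_lower_increasing x y : 0 < x -> x < y -> log_lower x < log_lower y.
Proof.
intros hx hxy.
apply (mvt_pos log_lower (fun s => (g s + one_plus_inv s * crit_re s) / (s * g s)) x y hxy).
  intros c hc; apply is_derive_log_lower; lra.
intros c hc; apply Rdiv_lt_0_compat; [apply log_lower_slope_pos; lra|].
apply Rmult_lt_0_compat; [lra|apply g_pos].
Qed.

(** Squaring, the claim becomes [2 (ln s - 1) / s < PI ^ 2 + / s ^ 2]. *)
Lemma log_lower_lt_1 s : 0 < s -> log_lower s < 1.
Proof.
intros hs; unfold log_lower; assert (hg := g_pos s); assert (e := g_sq s).
assert (hi := Rinv_0_lt_compat s hs); assert (pi8 := PI_sq_gt_8).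
cut (ln s - 1 < g s); [lra|].
apply lt_of_sq_lt; [lra|]; rewrite e; unfold crit_re.
assert (lns : ln s <= s - 1).
  rewrite <- (ln_exp (s - 1)); apply ln_le; [exact hs|].
  assert (k := exp_ineq1_le (s - 1)); lra.
assert (is1 : / s * s = 1) by (apply Rinv_l; lra).
set (i := / s) in *; set (l := ln s) in *.
assert (i * l <= i * (s - 1)) by (apply Rmult_le_compat_l; lra).
nra.
Qed.

Lemma log_lower_reaches c : c < 1 -> exists s, 0 < s /\ c < log_lower s.
Proof.
intros hc; assert (pi8 := PI_sq_gt_8).
(* For [s = exp y] it is enough that [(y - 1 + d)^2 > PI^2 + (y - 1)^2]. *)
set (d := 1 - c); set (y := 2 + PI ^ 2 / d).
assert (hy : 2 < y) by (unfold y; assert (0 < PI ^ 2 / d) by (apply Rdiv_lt_0_compat; unfold d; lra); lra).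
exists (exp y); split; [apply exp_pos|].
unfold log_lower; rewrite ln_exp.
cut (g (exp y) < y - c); [lra|].
apply lt_of_sq_lt; [lra|]; rewrite g_sq; unfold crit_re; rewrite ln_exp, <- exp_Ropp.
assert (e0 := exp_pos (- y)).
assert (e1 : exp (- y) < 1) by (rewrite <- exp_0; apply exp_increasing; lra).
assert (k : (1 + exp (- y) - y) ^ 2 <= (y - 1) ^ 2).
  replace ((1 + exp (- y) - y) ^ 2) with ((y - 1 - exp (- y)) ^ 2) by ring; apply pow_incr; lra.
assert (dy : d * y = 2 * d + PI ^ 2) by (unfold y; field; unfold d; lra).
assert (d0 : 0 < d) by (unfold d; lra).
replace (y - c) with (y - 1 + d) by (unfold d; ring); nra.
Qed.

Lemma continuity_of_derive (f : R -> R) x l : is_derive f x l -> continuity_pt f x.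
Proof. intros h; apply derivable_continuous_pt; exists l; now apply is_derive_Reals. Qed.

Lemma log_lower_root alpha : 0 < alpha < exp 1 ->
  exists s, 0 < s /\ log_lower s = ln alpha.
Proof.
intros [ha he].
assert (hl : ln alpha < 1) by (rewrite <- (ln_exp 1); now apply ln_increasing).
destruct (log_lower_reaches _ hl) as [t [ht hlt]].
assert (hat : alpha < t).
  apply ln_lt_inv; try lra; unfold log_lower in hlt; assert (hg := g_pos t); lra.
destruct (IVT_interv (fun s => log_lower s - ln alpha) alpha t) as [s [hs e]]; try lra.
- intros s hs; apply continuity_pt_minus; [|apply continuity_pt_const; easy].
  eapply continuity_of_derive, is_derive_log_lower; lra.
- unfold log_lower; assert (hg := g_pos alpha); lra.
- exists s; split; lra.
Qed.

(** The slope of [log_upper] has the sign of [g - q h], where [q] is [one_plus_inv]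
    and [h] is [crit_re].  For [h > 0] the inequality [g <= q h] means
    [PI ^ 2 <= h ^ 2 (q ^ 2 - 1)], whose right-hand side decreases.  So the
    slope changes sign at most once, from negative to positive. *)
Lemma log_upper_slope_sign x y : 0 < x -> x < y ->
  g y <= one_plus_inv y * crit_re y -> g x < one_plus_inv x * crit_re x.
Proof.
intros hx hxy hy.
assert (gx := g_pos x); assert (gy := g_pos y); assert (ex := g_sq x); assert (ey := g_sq y).
assert (qy := q_gt_1 y ltac:(lra)).
assert (hpos : 0 < crit_re y) by (apply Rmult_lt_reg_l with (one_plus_inv y); lra).
assert (qxy : one_plus_inv y < one_plus_inv x).
  unfold one_plus_inv; assert (/ y < / x) by (apply Rinv_lt_contravar; [apply Rmult_lt_0_compat; lra|lra]); lra.
assert (hxy' : crit_re y < crit_re x).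
  assert (ln x < ln y) by (apply ln_increasing; lra); unfold crit_re, one_plus_inv in *; lra.
apply lt_of_sq_lt; [apply Rmult_le_pos; lra|]; rewrite ex.
assert (k1 : g y ^ 2 <= (one_plus_inv y * crit_re y) ^ 2) by (apply pow_incr; lra).
assert (k2 : crit_re y ^ 2 < crit_re x ^ 2) by nra.
assert (k3 : one_plus_inv y ^ 2 < one_plus_inv x ^ 2) by nra.
assert (k4 : 1 < one_plus_inv y ^ 2) by nra.
assert (crit_re y ^ 2 * (one_plus_inv y ^ 2 - 1) < crit_re x ^ 2 * (one_plus_inv x ^ 2 - 1)).
  assert (0 < crit_re y ^ 2) by (apply pow_lt; lra).
  apply Rmult_gt_0_lt_compat; lra.
nra.
Qed.

(** Squaring the critical equation gives [g ^ 2 = (q h) ^ 2], and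
    [g = - q h] is excluded by the positive slope of [log_lower]. *)
Lemma critical_eq_iff s : 0 < s -> (critical_eq s <-> g s = one_plus_inv s * crit_re s).
Proof.
intros hs; assert (hg := g_pos s); assert (e := g_sq s); assert (hq := q_gt_1 s hs).
assert (hl := log_lower_slope_pos s hs); assert (hpi := PI_RGT_0).
unfold critical_eq; fold (one_plus_inv s).
assert (w0 : 0 < one_plus_inv s ^ 2 - 1) by nra.
assert (w := sqrt_lt_R0 _ w0); assert (w2 := pow2_sqrt _ (Rlt_le _ _ w0)).
set (v := sqrt (one_plus_inv s ^ 2 - 1)) in *.
split; intros h.
- assert (k : g s * v = PI * one_plus_inv s) by (rewrite <- h; field; lra).
  assert (k2 : (g s - one_plus_inv s * crit_re s) * (g s + one_plus_inv s * crit_re s) = 0).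
    assert (k3 : g s ^ 2 * v ^ 2 = PI ^ 2 * one_plus_inv s ^ 2) by (rewrite <- !Rpow_mult_distr, k; reflexivity).
    rewrite w2 in k3; replace (PI ^ 2) with (g s ^ 2 - crit_re s ^ 2) in k3 by lra; lra.
  apply Rmult_integral in k2; lra.
- apply Rmult_eq_reg_r with (one_plus_inv s); [|lra].
  replace (g s * v / one_plus_inv s * one_plus_inv s) with (g s * v) by (field; lra).
  assert (k : (g s * v) ^ 2 = (PI * one_plus_inv s) ^ 2).
    rewrite !Rpow_mult_distr, w2; replace (PI ^ 2) with (g s ^ 2 - crit_re s ^ 2) by lra.
    rewrite h; ring.
  assert (0 < g s * v) by now apply Rmult_lt_0_compat.
  assert (0 < PI * one_plus_inv s) by (apply Rmult_lt_0_compat; lra).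
  assert (k' : (g s * v - PI * one_plus_inv s) * (g s * v + PI * one_plus_inv s) = 0) by lra.
  apply Rmult_integral in k'; lra.
Qed.

Section Critical.
Variable sc : R.
Hypotheses (hsc : 0 < sc) (crit : g sc = one_plus_inv sc * crit_re sc).

Lemma log_upper_decreasing x y : 0 < x -> x < y -> y <= sc -> log_upper y < log_upper x.
Proof.
intros hx hxy hy.
cut (- log_upper x < - log_upper y); [lra|].
apply (mvt_pos (fun s => - log_upper s) (fun s => - ((g s - one_plus_inv s * crit_re s) / (s * g s))) x y hxy).
  intros c hc; apply (is_derive_opp log_upper), is_derive_log_upper; lra.
intros c hc; assert (hg := g_pos c).
assert (k := log_upper_slope_sign c sc ltac:(lra) ltac:(lra) (Req_le _ _ crit)).
replace (- _) with ((one_plus_inv c * crit_re c - g c) / (c * g c)) by (field; lra).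
apply Rdiv_lt_0_compat; [lra|apply Rmult_lt_0_compat; lra].
Qed.

Lemma log_upper_increasing x y : sc <= x -> x < y -> log_upper x < log_upper y.
Proof.
intros hx hxy.
apply (mvt_pos log_upper (fun s => (g s - one_plus_inv s * crit_re s) / (s * g s)) x y hxy).
  intros c hc; apply is_derive_log_upper; lra.
intros c hc; assert (hg := g_pos c).
apply Rdiv_lt_0_compat; [|apply Rmult_lt_0_compat; lra].
apply Rnot_le_lt; intros k.
assert (k' := log_upper_slope_sign sc c hsc ltac:(lra) ltac:(lra)); lra.
Qed.

Lemma log_upper_min s : 0 < s -> log_upper sc <= log_upper s.
Proof.
intros hs; destruct (Rtotal_order s sc) as [h|[->|h]]; [|lra|].
  left; apply log_upper_decreasing; lra.
left; apply log_upper_increasing; lra.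
Qed.

Lemma log_upper_roots l : 1 < l -> 1 < sc -> log_upper sc < l ->
  exists mu nu, 0 < mu < sc /\ sc < nu /\ log_upper mu = l /\ log_upper nu = l.
Proof.
intros hl hs1 hl'.
assert (il : / l < 1) by (rewrite <- Rinv_1; apply Rinv_lt_contravar; lra).
assert (il0 : 0 < / l) by (apply Rinv_0_lt_compat; lra).
assert (hcont : forall s, 0 < s -> continuity_pt log_upper s).
  intros s hs; eapply continuity_of_derive, is_derive_log_upper, hs.
(* As [crit_re < g], one has [1 + / s < log_upper s]; take [s = / l]. *)
assert (up_l : l < log_upper (/ l)).
  assert (hg := g_pos (/ l)); assert (e := g_sq (/ l)).
  assert (crit_re (/ l) < g (/ l)).
    apply lt_of_sq_lt; [lra|]; assert (p8 := PI_sq_gt_8); lra.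
  unfold log_upper, crit_re in *; rewrite Rinv_inv in *; lra.
assert (up_r : l < log_upper (exp l)).
  unfold log_upper; rewrite ln_exp; assert (hg := g_pos (exp l)); lra.
assert (sc_exp : sc < exp l).
  apply ln_lt_inv; [lra|apply exp_pos|]; rewrite ln_exp.
  unfold log_upper in hl'; assert (hg := g_pos sc); lra.
destruct (IVT_interv (fun s => l - log_upper s) (/ l) sc) as [mu [hmu emu]]; try lra.
  intros s hs; apply continuity_pt_minus; [apply continuity_pt_const; easy|apply hcont; lra].
destruct (IVT_interv (fun s => log_upper s - l) sc (exp l)) as [nu [hnu enu]]; try lra.
  intros s hs; apply continuity_pt_minus; [apply hcont; lra|apply continuity_pt_const; easy].
assert (mu <> sc) by (intros ->; lra); assert (nu <> sc) by (intros ->; lra).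
exists mu, nu; repeat split; lra.
Qed.
End Critical.

Lemma sigma_lt_iff alpha x m : 0 < alpha -> 1 < x -> 0 < m ->
  (sigma_of alpha x < m <-> exp (alpha / m) < x)
  /\ (m < sigma_of alpha x <-> x < exp (alpha / m)).
Proof.
intros ha hx hm.
assert (hl : 0 < ln x) by (rewrite <- ln_1; apply ln_increasing; lra).
assert (ex : x = exp (ln x)) by (rewrite exp_ln; lra).
set (l := ln x) in *.
assert (e : sigma_of alpha x * l = alpha) by (unfold sigma_of; fold l; field; lra).
assert (e' : alpha / m * m = alpha) by (field; lra).
set (u := alpha / m) in *; set (v := sigma_of alpha x) in *.
assert (v0 : 0 < v) by (apply Rmult_lt_reg_r with l; lra).
assert (exp_lt : forall y z, exp y < exp z <-> y < z) by (intros; split; [apply exp_lt_inv|apply exp_increasing]).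
rewrite ex, !exp_lt; repeat split; intros h; apply Rnot_le_lt; intros k; nra.
Qed.

(** * Numerical values *)

(** Partial sums of the alternating series of
    [PI / 4 = 2 atan (/ 3) + atan (/ 7)]. *)
Lemma PI_bounds : 3.1415926535897 <= PI <= 3.1415926535898.
Proof.
destruct (PI_2_3_7_ineq 6) as [lo _]; destruct (PI_2_3_7_ineq 7) as [_ hi].
assert (lo' : 3.1415926535897 / 4 <= sum_f_R0 (tg_alt PI_2_3_7_tg) (S (2 * 6))).
  unfold sum_f_R0, tg_alt, PI_2_3_7_tg, Ratan_seq; cbn -[INR]; rewrite !INR_IZR_INZ; cbn -[IZR]; lra.
assert (hi' : sum_f_R0 (tg_alt PI_2_3_7_tg) (2 * 7) <= 3.1415926535898 / 4).
  unfold sum_f_R0, tg_alt, PI_2_3_7_tg, Ratan_seq; cbn -[INR]; rewrite !INR_IZR_INZ; cbn -[IZR]; lra.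
lra.
Qed.

Definition exp_taylor (n : nat) (x : R) : R := sum_f_R0 (fun k => / INR (fact k) * x ^ k) n.

Lemma is_derive_exp_taylor n x : is_derive (exp_taylor (S n)) x (exp_taylor n x).
Proof.
induction n as [|n IH].
  unfold exp_taylor; simpl; auto_derive; [exact I|field].
apply (is_derive_ext (fun x => exp_taylor (S n) x + / INR (fact (S (S n))) * x ^ S (S n))); [reflexivity|].
eapply is_derive_eq.
  apply (is_derive_plus (exp_taylor (S n))); [exact IH|].
  apply is_derive_scal, (is_derive_pow (fun x => x)), is_derive_id.
change (exp_taylor n x + / INR (fact (S (S n))) * (INR (S (S n)) * 1 * x ^ S n) = exp_taylor (S n) x).
unfold exp_taylor; rewrite tech5, (fact_simpl (S n)), mult_INR.
assert (f := INR_fact_lt_0 (S n)); field; split; [lra|apply not_0_INR; lia].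
Qed.

Lemma le_of_derive (f k : R -> R) f' k' x : 0 <= x <= 1 -> f 0 <= k 0 ->
  (forall c, is_derive f c (f' c)) -> (forall c, is_derive k c (k' c)) ->
  (forall c, 0 <= c <= 1 -> f' c <= k' c) -> f x <= k x.
Proof.
intros [[hx|<-] hx1] h0 df dk h; [|exact h0].
destruct (MVT_cor2 (fun t => k t - f t) (fun t => k' t - f' t) 0 x hx) as [c [e hc]].
  intros c _; apply is_derive_Reals, (is_derive_minus k f); [apply dk|apply df].
assert (0 <= (k' c - f' c) * (x - 0)) by (apply Rmult_le_pos; [assert (hh := h c ltac:(lra)); lra|lra]).
lra.
Qed.

Lemma exp_taylor_0 n : exp_taylor n 0 = 1.
Proof.
unfold exp_taylor; induction n as [|n IH]; [simpl; field|].
rewrite tech5, IH, pow_i by lia; ring.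
Qed.

(** Integrating the bounds for [n] gives those for [n + 1]; the constant [3]
    bounds [exp] on the unit interval. *)
Lemma exp_taylor_bounds n x : 0 <= x <= 1 ->
  exp_taylor n x <= exp x <= exp_taylor n x + 3 * (/ INR (fact (S n)) * x ^ S n).
Proof.
revert x; induction n as [|n IH]; intros x hx.
  split.
    unfold exp_taylor; simpl; assert (h := exp_ineq1_le x); lra.
  apply (le_of_derive exp (fun x => exp_taylor 0 x + 3 * (/ INR (fact 1) * x ^ 1)) exp (fun _ => 3)); [exact hx| | | |].
  - rewrite exp_0, exp_taylor_0; simpl; lra.
  - intros c; apply is_derive_exp.
  - intros c; unfold exp_taylor; simpl; auto_derive; [exact I|field].
  - intros c hc; apply Rle_trans with (2 := exp_le_3).
    destruct (proj2 hc) as [h| ->]; [left; now apply exp_increasing|lra].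
split.
- apply (le_of_derive (exp_taylor (S n)) exp (exp_taylor n) exp); [exact hx| | | |].
  + rewrite exp_0, exp_taylor_0; lra.
  + intros c; apply is_derive_exp_taylor.
  + intros c; apply is_derive_exp.
  + intros c hc; apply IH, hc.
- apply (le_of_derive exp (fun x => exp_taylor (S n) x + 3 * (/ INR (fact (S (S n))) * x ^ S (S n)))
     exp (fun x => exp_taylor n x + 3 * (/ INR (fact (S n)) * x ^ S n))); [exact hx| | | |].
  + rewrite exp_0, exp_taylor_0, pow_i by lia; lra.
  + intros c; apply is_derive_exp.
  + intros c; eapply is_derive_eq.
      apply (is_derive_plus (exp_taylor (S n))); [apply is_derive_exp_taylor|].
      apply is_derive_scal, is_derive_scal, (is_derive_pow (fun x => x)), is_derive_id.
    change (exp_taylor n c + 3 * (/ INR (fact (S (S n))) * (INR (S (S n)) * 1 * c ^ S n)) =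
      exp_taylor n c + 3 * (/ INR (fact (S n)) * c ^ S n)).
    rewrite (fact_simpl (S n)), mult_INR.
    assert (f := INR_fact_lt_0 (S n)); field; split; [lra|apply not_0_INR; lia].
  + intros c hc; apply IH, hc.
Qed.

(* The factorials are split into products of real numbers: evaluating them
   in unary notation is too slow. *)
Ltac eval_taylor :=
  unfold exp_taylor, sum_f_R0; rewrite ?fact_simpl, ?mult_INR;
  change (fact 0) with 1%nat; rewrite !INR_IZR_INZ; cbn -[IZR]; lra.

Lemma exp_le_num n x y : 0 <= x <= 1 ->
  exp_taylor n x + 3 * (/ INR (fact (S n)) * x ^ S n) <= y -> exp x <= y.
Proof. intros hx h; eapply Rle_trans; [apply exp_taylor_bounds, hx|exact h]. Qed.

Lemma exp_ge_num n x y : 0 <= x <= 1 -> y <= exp_taylor n x -> y <= exp x.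
Proof. intros hx h; eapply Rle_trans; [exact h|apply exp_taylor_bounds, hx]. Qed.

Lemma ln_bounds_num a b x n : 0 <= a -> 0 <= b <= 1 -> a <= 1 -> 0 < x ->
  exp_taylor n a + 3 * (/ INR (fact (S n)) * a ^ S n) <= x -> x <= exp_taylor n b ->
  a <= ln x <= b.
Proof.
intros ha hb ha1 hx h1 h2; split.
- rewrite <- (ln_exp a); apply ln_le; [apply exp_pos|]; eapply exp_le_num; [lra|exact h1].
- rewrite <- (ln_exp b); apply ln_le; [exact hx|]; eapply exp_ge_num; [lra|exact h2].
Qed.

Lemma ln_s0 : 0.05821750397 <= ln 1.059945513 <= 0.05821750398.
Proof. apply (ln_bounds_num _ _ _ 7); [lra|lra|lra|lra|eval_taylor|eval_taylor]. Qed.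

Lemma ln_s1 : 0.05821750491 <= ln 1.059945514 <= 0.05821750492.
Proof. apply (ln_bounds_num _ _ _ 7); [lra|lra|lra|lra|eval_taylor|eval_taylor]. Qed.

Lemma h_s0 : 1.88522721816 <= crit_re 1.059945513 <= 1.88522721818.
Proof. assert (h := ln_s0); unfold crit_re; lra. Qed.

Lemma h_s1 : 1.88522721633 <= crit_re 1.059945514 <= 1.88522721635.
Proof. assert (h := ln_s1); unfold crit_re; lra. Qed.

Lemma sq_bounds a b x : a <= x <= b -> 0 <= a -> a ^ 2 <= x ^ 2 <= b ^ 2.
Proof. intros hx ha; split; apply pow_incr; lra. Qed.

Lemma slope_s0 : g 1.059945513 < one_plus_inv 1.059945513 * crit_re 1.059945513.
Proof.
assert (hh := h_s0); assert (hp := PI_bounds); set (h := crit_re _) in *.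
assert (h2 := sq_bounds _ _ h hh ltac:(lra)); assert (p2 := sq_bounds _ _ PI hp ltac:(lra)).
apply lt_of_sq_lt; [unfold one_plus_inv; apply Rmult_le_pos; lra|]; rewrite g_sq; fold h.
rewrite Rpow_mult_distr; unfold one_plus_inv; lra.
Qed.

Lemma slope_s1 : one_plus_inv 1.059945514 * crit_re 1.059945514 < g 1.059945514.
Proof.
assert (hh := h_s1); assert (hp := PI_bounds); set (h := crit_re _) in *.
assert (h2 := sq_bounds _ _ h hh ltac:(lra)); assert (p2 := sq_bounds _ _ PI hp ltac:(lra)).
apply lt_of_sq_lt; [left; apply g_pos|]; rewrite g_sq; fold h.
rewrite Rpow_mult_distr; unfold one_plus_inv; lra.
Qed.

Lemma g_s0 : g 1.059945513 <= 3.6638348852.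
Proof.
assert (hh := h_s0); assert (hp := PI_bounds); assert (e := g_sq 1.059945513); set (h := crit_re _) in *.
assert (h2 := sq_bounds _ _ h hh ltac:(lra)); assert (p2 := sq_bounds _ _ PI hp ltac:(lra)).
apply Rnot_lt_le; intros k; assert (3.6638348852 ^ 2 <= g 1.059945513 ^ 2) by (apply pow_incr; lra); lra.
Qed.

Lemma g_s1 : 3.6638348840 <= g 1.059945514.
Proof.
assert (hh := h_s1); assert (hp := PI_bounds); assert (e := g_sq 1.059945514); set (h := crit_re _) in *.
assert (h2 := sq_bounds _ _ h hh ltac:(lra)); assert (p2 := sq_bounds _ _ PI hp ltac:(lra)).
left; apply lt_of_sq_lt; [left; apply g_pos|]; lra.
Qed.

(** Brings the argument of [exp] into the unit interval. *)
Lemma exp_eighth x : exp (8 * x) = exp x ^ 8.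
Proof. replace (8 * x) with (x + x + x + x + x + x + x + x) by ring; rewrite !exp_plus; ring. Qed.

Lemma exp_g_hi : 1.059945513 * exp 3.6638348852 < 41.349172.
Proof.
replace 3.6638348852 with (8 * 0.45797936065) by lra; rewrite exp_eighth.
assert (h : exp 0.45797936065 <= 1.58087637447) by (apply (exp_le_num 12); [lra|eval_taylor]).
assert (h8 : exp 0.45797936065 ^ 8 <= 1.58087637447 ^ 8) by (apply pow_incr; split; [left; apply exp_pos|exact h]).
lra.
Qed.

Lemma exp_g_lo : 41.349171 <= 1.059945513 * exp 3.6638348840.
Proof.
replace 3.6638348840 with (8 * 0.4579793605) by lra; rewrite exp_eighth.
assert (h : 1.5808763742 <= exp 0.4579793605) by (apply (exp_ge_num 12); [lra|eval_taylor]).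
assert (h8 : 1.5808763742 ^ 8 <= exp 0.4579793605 ^ 8) by (apply pow_incr; split; [lra|exact h]).
lra.
Qed.

(** Nine decimals of the critical point, rather than the six that are wanted
    for it, let the crude bounds below give six decimals of the critical
    value. *)
Lemma critical_point :
  exists sc, 1.059945513 < sc < 1.059945514 /\ g sc = one_plus_inv sc * crit_re sc.
Proof.
destruct (IVT_interv (fun s => g s - one_plus_inv s * crit_re s) 1.059945513 1.059945514) as [sc [hs e]]; try lra.
- intros s hs; eapply continuity_of_derive.
  apply (is_derive_minus g (fun s => one_plus_inv s * crit_re s)).
    apply is_derive_g; lra.
  unfold one_plus_inv, crit_re; auto_derive; [|reflexivity]; repeat split; lra.
- assert (h := slope_s0); lra.
- assert (h := slope_s1); lra.
- assert (h0 := slope_s0); assert (h1 := slope_s1).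
  exists sc; split; [|lra].
  assert (sc <> 1.059945513) by (intros ->; lra).
  assert (sc <> 1.059945514) by (intros ->; lra).
  lra.
Qed.

(** The upper bound needs no information on [sc] beyond its being the point
    where [log_upper] is minimal; the lower bound uses that [ln] increases and
    that [g] decreases on the short interval. *)
Lemma critical_value sc : 1.059945513 < sc < 1.059945514 -> g sc = one_plus_inv sc * crit_re sc ->
  41.349171 <= sc * exp (g sc) < 41.349172.
Proof.
intros hs e; split.
- assert (hg : 3.6638348840 <= g sc).
    eapply Rle_trans; [apply g_s1|]; left; apply lt_of_sq_lt; [left; apply g_pos|]; rewrite !g_sq.
    apply Rplus_lt_compat_l.
    assert (h1 := h_s1).
    assert (crit_re 1.059945514 < crit_re sc).
      unfold crit_re; assert (/ 1.059945514 < / sc) by (apply Rinv_lt_contravar; lra).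
      assert (ln sc < ln 1.059945514) by (apply ln_increasing; lra); lra.
    nra.
  eapply Rle_trans; [apply exp_g_lo|].
  apply Rmult_le_compat; [lra|left; apply exp_pos|lra|].
  destruct hg as [hg| <-]; [left; now apply exp_increasing|lra].
- assert (up := log_upper_min sc ltac:(lra) e 1.059945513 ltac:(lra)).
  apply Rle_lt_trans with (2 := exp_g_hi).
  rewrite <- (exp_ln sc) at 1 by lra; rewrite <- exp_plus; fold (log_upper sc).
  apply Rle_trans with (exp (log_upper 1.059945513)).
    destruct up as [up| ->]; [left; now apply exp_increasing|lra].
  unfold log_upper; rewrite exp_plus, exp_ln by lra; apply Rmult_le_compat_l; [lra|].
  destruct g_s0 as [k| ->]; [left; now apply exp_increasing|lra].
Qed.

(** * The domain of convergence *)
Theorem theorem13 :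
  exists sigma_c : R,
    unique (fun s : R => 0 < s /\ critical_eq s) sigma_c /\
    1.059945 <= sigma_c < 1.059946 /\
    exists alpha_c : R,
      alpha_c = sigma_c * exp (g sigma_c) /\
      41.349171 <= alpha_c < 41.349172 /\
      (* (i) *)
      (forall alpha : R, 0 < alpha < exp 1 ->
         exists sigma_a : R,
           unique (fun s : R => 0 < s /\ ln s - g s = ln alpha) sigma_a /\
           forall x : R, 1 < x ->
             (0 < sigma_of alpha x < sigma_a <-> exp (alpha / sigma_a) < x) /\
             (0 < sigma_of alpha x < sigma_a -> series_converges alpha x) /\
             (sigma_a < sigma_of alpha x <-> x < exp (alpha / sigma_a)) /\
             (sigma_a < sigma_of alpha x -> ~ series_converges alpha x)) /\
      (* (ii) *)
      (forall alpha : R, exp 1 < alpha < alpha_c ->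
         (forall s : R, 0 < s <-> exists x : R, 1 < x /\ s = sigma_of alpha x) /\
         (forall x : R, 1 < x -> series_converges alpha x)) /\
      (* (iii) *)
      (forall alpha : R, alpha_c < alpha ->
         exists mu nu : R,
           0 < mu < nu /\
           (forall s : R, 0 < s ->
              (Rabs (ln s - ln alpha) = g s <-> s = mu \/ s = nu)) /\
           forall x : R, 1 < x ->
             (sigma_of alpha x < mu \/ nu < sigma_of alpha x <->
              exp (alpha / mu) < x \/ x < exp (alpha / nu)) /\
             (sigma_of alpha x < mu \/ nu < sigma_of alpha x ->
              series_converges alpha x) /\
             (mu < sigma_of alpha x < nu <->
              exp (alpha / nu) < x < exp (alpha / mu)) /\
             (mu < sigma_of alpha x < nu -> ~ series_converges alpha x)).
Proof.
destruct critical_point as [sc [hsc crit]].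
assert (sc0 : 0 < sc) by lra.
assert (val := critical_value sc hsc crit).
set (ac := sc * exp (g sc)) in *.
assert (up_c : log_upper sc = ln ac).
  unfold ac; rewrite ln_mult, ln_exp by (try apply exp_pos; lra); reflexivity.
assert (ac_e : 1 < ln ac).
  rewrite <- (ln_exp 1); apply ln_increasing; [apply exp_pos|].
  assert (h := exp_le_3); lra.
assert (Rabs_lt : forall a s, ln s - g s < ln a < ln s + g s -> Rabs (ln a - ln s) < g s).
  intros a s h; apply Rabs_def1; lra.
exists sc; repeat match goal with |- _ /\ _ => split end; try lra.
- split; [split; [exact sc0|now apply critical_eq_iff]|].
  intros s [hs cs]; apply critical_eq_iff in cs; [|exact hs].
  destruct (Rtotal_order sc s) as [h|[h|h]]; [|exact h|].
  + assert (k := log_upper_slope_sign sc s sc0 h (Req_le _ _ cs)); lra.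
  + assert (k := log_upper_slope_sign s sc hs h (Req_le _ _ crit)); lra.
- exists ac; repeat match goal with |- _ /\ _ => split end; try lra; [reflexivity| | |].
  + intros alpha ha.
    destruct (log_lower_root alpha ha) as [sa [hsa esa]].
    assert (la : ln alpha < 1) by (rewrite <- (ln_exp 1); apply ln_increasing; lra).
    exists sa; split.
      split; [split; [exact hsa|exact esa]|].
      intros s [hs es]; fold (log_lower s) in es.
      destruct (Rtotal_order sa s) as [h|[h|h]]; [|exact h|];
        apply log_lower_increasing in h; lra.
    intros x hx; assert (hs := sigma_of_pos alpha x ltac:(lra) hx).
    destruct (sigma_lt_iff alpha x sa ltac:(lra) hx hsa) as [i1 i2].
    split; [rewrite <- i1; split; [tauto|now split]|].
    split; [|split; [exact i2|]].
    * intros [_ h]; apply log_lower_increasing in h; [|exact hs].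
      apply series_converges_inside; [lra|exact hx|].
      assert (m := log_upper_min sc sc0 crit _ hs); apply Rabs_lt.
      unfold log_upper, log_lower in *; lra.
    * intros h; apply log_lower_increasing in h; [|exact hsa].
      apply series_diverges_outside; [lra|exact hx|].
      assert (hg := g_pos (sigma_of alpha x)); unfold log_lower in *; rewrite Rabs_left1; lra.
  + intros alpha [ha1 ha2]; assert (e0 := exp_pos 1).
    assert (la : 1 < ln alpha < ln ac).
      split; [rewrite <- (ln_exp 1)|]; apply ln_increasing; lra.
    split.
      intros s; split.
        intros hs; exists (exp (alpha / s)).
        assert (0 < alpha / s) by (apply Rdiv_lt_0_compat; lra).
        split; [rewrite <- exp_0; now apply exp_increasing|].
        unfold sigma_of; rewrite ln_exp; field; lra.
      intros [x [hx ->]]; apply sigma_of_pos; lra.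
    intros x hx; assert (hs := sigma_of_pos alpha x ltac:(lra) hx).
    apply series_converges_inside; [lra|exact hx|].
    assert (m := log_upper_min sc sc0 crit _ hs); assert (m' := log_lower_lt_1 _ hs).
    apply Rabs_lt; unfold log_upper, log_lower in *; lra.
  + intros alpha ha; assert (a0 : 0 < alpha) by lra.
    assert (la : ln ac < ln alpha) by (apply ln_increasing; lra).
    destruct (log_upper_roots sc sc0 (ln alpha)) as [mu [nu [hmu [hnu [emu enu]]]]]; try lra.
    assert (dec := log_upper_decreasing sc crit); assert (inc := log_upper_increasing sc sc0 crit).
    assert (left_mu : forall s, 0 < s -> s < mu -> ln alpha < log_upper s).
      intros s hs h; rewrite <- emu; apply dec; lra.
    assert (right_nu : forall s, nu < s -> ln alpha < log_upper s).
      intros s h; rewrite <- enu; apply inc; lra.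
    assert (between : forall s, mu < s < nu -> log_upper s < ln alpha).
      intros s h; destruct (Rle_or_lt s sc).
        rewrite <- emu; apply dec; lra.
      rewrite <- enu; apply inc; lra.
    exists mu, nu; split; [lra|split].
      intros s hs; assert (m' := log_lower_lt_1 s hs); unfold log_lower in m'; split.
        intros h; assert (e : log_upper s = ln alpha).
          unfold log_upper; revert h; unfold Rabs; destruct (Rcase_abs _); intros h; lra.
        destruct (Rtotal_order s mu) as [h1|[h1|h1]]; [|now left|].
          assert (k := left_mu s hs h1); lra.
        destruct (Rtotal_order s nu) as [h2|[h2|h2]]; [|now right|].
          assert (k := between s (conj h1 h2)); lra.
        assert (k := right_nu s h2); lra.
      assert (hg := g_pos s).
      intros [-> | ->]; unfold log_upper in emu, enu; rewrite Rabs_left1; lra.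
    intros x hx; assert (hs := sigma_of_pos alpha x a0 hx).
    destruct (sigma_lt_iff alpha x mu a0 hx ltac:(lra)) as [i1 i2].
    destruct (sigma_lt_iff alpha x nu a0 hx ltac:(lra)) as [i3 i4].
    rewrite <- i1, <- i2, <- i3, <- i4.
    assert (m' := log_lower_lt_1 _ hs).
    split; [tauto|split; [|split; [tauto|]]].
    * intros h; apply series_converges_inside; [exact a0|exact hx|]; apply Rabs_lt.
      assert (k : ln alpha < log_upper (sigma_of alpha x)) by (destruct h; auto).
      unfold log_upper, log_lower in *; lra.
    * intros h; apply series_diverges_outside; [exact a0|exact hx|].
      assert (k := between _ h); assert (hg := g_pos (sigma_of alpha x)).
      unfold log_upper in k; rewrite Rabs_pos_eq; lra.
Qed.
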